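(* The categories $\mathbf{AS}$ (algebraic structures with interpretations up to equality as morphisms) and $\mathbf{PLG}$ (categories of projective logical sets with interpretation functors as morphisms) are isomorphic.
   Context: **Structures and codes.** $\mathbb{A}=\langle A;L(\mathbb{A})\rangle$ denotes a first-order structure with non-empty underlying set $A$ in the language $L(\mathbb{A})$ (logic with equality; constant, function and predicate symbols); similarly for other letters. For $P\subseteq A$, $\mathbb{A}_P$ is the expansion of $\mathbb{A}$ by constants naming the elements of $P$. Maps are applied to tuples coordinatewise. An interpretation code $\Gamma\colon L(\mathbb{A})\to L(\mathbb{B})$ is a family of $L(\mathbb{B})$-formulas $U_\Gamma(\bar x,\bar y)$, $E_\Gamma(\bar x,\bar x',\bar y)$, $c_\Gamma(\bar x,\bar y)$, $f_\Gamma(\bar x_0,\bar x_1,\ldots,\bar x_{n_f},\bar y)$, $R_\Gamma(\bar x_1,\ldots,\bar x_{n_R},\bar y)$, one for each constant symbol $c$, function symbol $f$, predicate symbol $R$ of $L(\mathbb{A})$, where all tuples $\bar x,\bar x',\bar x_i$ have the same length $\dim\Gamma$ and $|\bar y|=\dim_{\mathrm{par}}\Gamma$. For a tuple $\bar p$ from $B$ with $|\bar p|=\dim_{\mathrm{par}}\Gamma$ put $U_\Gamma(\mathbb{B},\bar p)=\{\bar b\mid\mathbb{B}\models U_\Gamma(\bar b,\bar p)\}$. The $L(\mathbb{A})$-structure $\Gamma(\mathbb{B},\bar p)$ is well-defined if $U_\Gamma(\mathbb{B},\bar p)\neq\emptyset$ and, on $U_\Gamma(\mathbb{B},\bar p)$,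 $E_\Gamma(\cdot,\cdot,\bar p)$ defines an equivalence relation $\sim_\Gamma$, each $c_\Gamma$ defines exactly one $\sim_\Gamma$-class, each $f_\Gamma$ defines (the preimage of) the graph $x_0=f(x_1,\ldots,x_{n_f})$ of an operation on $U_\Gamma(\mathbb{B},\bar p)/{\sim_\Gamma}$, and each $R_\Gamma$ defines (the preimage of) a relation on $U_\Gamma(\mathbb{B},\bar p)/{\sim_\Gamma}$; then $\Gamma(\mathbb{B},\bar p)$ is the resulting structure on $U_\Gamma(\mathbb{B},\bar p)/{\sim_\Gamma}$. An interpretation $(\Gamma,\bar p,\mu_\Gamma)\colon\mathbb{A}\rightsquigarrow\mathbb{B}$ consists of a code $\Gamma$, a tuple $\bar p$ such that $\Gamma(\mathbb{B},\bar p)$ is well-defined, and a surjection (coordinate map) $\mu_\Gamma\colon U_\Gamma(\mathbb{B},\bar p)\to A$ that induces an $L(\mathbb{A})$-isomorphism $\bar\mu_\Gamma\colon\Gamma(\mathbb{B},\bar p)\to\mathbb{A}$, $\bar\mu_\Gamma(\bar b/{\sim_\Gamma})=\mu_\Gamma(\bar b)$. **Translations.** A formula is in normal form if it is prenex and its matrix is a disjunction of conjunctions of unnested atomic formulas ($x=x'$, $x=c$, $f(x_1,\ldots,x_{n_f})=x_0$, $R(x_1,\ldots,x_{n_R})$) and their negations. For an $L(\mathbb{A})$-formula $\psi(x_1,\ldots,x_s)$ in normal form, $\psi_\Gamma(\bar x_1,\ldots,\bar x_s,\bar y)$ is the $L(\mathbb{B})$-formula obtained by replacing each variable by a tuple of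 $\dim\Gamma$ variables, replacing the unnested atomic formulas by $E_\Gamma,c_\Gamma,f_\Gamma,R_\Gamma$ respectively, relativizing all quantifiers to $U_\Gamma(\cdot,\bar y)$, and adding the conjuncts $U_\Gamma(\bar x_i,\bar y)$ for all listed free variables. A formula not in normal form is translated via a logically equivalent normal form. An extended code $(\Gamma,\bar p,\gamma)\colon L(\mathbb{A})\cup A\to L(\mathbb{B})\cup B$ consists of a code $\Gamma\colon L(\mathbb{A})\to L(\mathbb{B})$, a tuple $\bar p$ from $B$ with $|\bar p|=\dim_{\mathrm{par}}\Gamma$, and a map $\gamma\colon A\to B^{\dim\Gamma}$. For a formula $\psi(x_1,\ldots,x_m,a_1,\ldots,a_s)$ of $L(\mathbb{A})\cup A$ (with constants $a_i\in A$) put $\psi_{\Gamma,\bar p,\gamma}(\bar x_1,\ldots,\bar x_m)=\psi_\Gamma(\bar x_1,\ldots,\bar x_m,\gamma(a_1),\ldots,\gamma(a_s),\bar p)$, where $\psi_\Gamma$ is the translation of $\psi(x_1,\ldots,x_m,z_1,\ldots,z_s)$. **Projective logical geometry.** For a set $S$ of $L(\mathbb{A})\cup A$-formulas in free variables $x_1,\ldots,x_m$ put $\mathrm{V}_{\mathbb{A}}(S)=\{\bar a\in A^m\mid\mathbb{A}_A\models\psi(\bar a)\ \forall\psi\in S\}$. Sets $X=\mathrm{V}_{\mathbb{A}}(S)$ are the logical sets over $\mathbb{A}$. An equivalence relation $\sim_X$ on a non-empty logical set $X\subseteq A^m$ is a formula equivalence, induced by an $L(\mathbb{A})\cup A$-formula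 $E(\bar x,\bar x')$, if for all $\bar a,\bar a'\in X$: $\bar a\sim_X\bar a'$ iff $\mathbb{A}_A\models E(\bar a,\bar a')$; and for all $\bar a\in X$, $\bar a'\in A^m$, $\mathbb{A}_A\models E(\bar a,\bar a')\vee E(\bar a',\bar a)$ implies $\bar a'\in X$. A projective logical set over $\mathbb{A}$ is a quotient $X/{\sim_X}$ of a non-empty logical set by a formula equivalence ($X$ is identified with $X/{=}$). A map $F\colon X/{\sim_X}\to Y/{\sim_Y}$ ($X\subseteq A^m$, $Y\subseteq A^s$) is a formula map, induced by an $L(\mathbb{A})\cup A$-formula $\varphi(\bar x,\bar y)$, if (I) for all $\bar a\in X,\bar b\in Y$: $F(\bar a/{\sim_X})=\bar b/{\sim_Y}$ iff $\mathbb{A}_A\models\varphi(\bar a,\bar b)$; (II) $\bar a\in X,\bar b\in A^s\setminus Y$ implies $\mathbb{A}_A\not\models\varphi(\bar a,\bar b)$. The category $\mathcal{PLS}(\mathbb{A})$ has as objects all projective logical sets over $\mathbb{A}$ and $\emptyset$; morphisms between non-empty objects are the formula maps; $\emptyset$ is an initial object and there are no morphisms from non-empty objects to $\emptyset$. **Interpretation functors.** Let $(\Gamma,\bar p,\gamma)\colon L(\mathbb{A})\cup A\to L(\mathbb{B})\cup B$ be an extended code; for a set $S$ of formulas put $S_{\Gamma,\bar p,\gamma}=\{\psi_{\Gamma,\bar p,\gamma}\mid\psi\in S\}$. Consider the following conditions, where all systems $S,S',S_X,\ldots$ are non-empty sets of formulas of $L(\mathbb{A})\cup A$ in finitely many free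 variables, and for $X=\mathrm{V}_{\mathbb{A}}(S_X)$ we write $\bar X=\mathrm{V}_{\mathbb{B}}((S_X)_{\Gamma,\bar p,\gamma})$ (conditions required for all choices of normal forms): (F1) $\mathrm{V}_{\mathbb{A}}(S)=\emptyset$ iff $\mathrm{V}_{\mathbb{B}}(S_{\Gamma,\bar p,\gamma})=\emptyset$; (F2) $\mathrm{V}_{\mathbb{A}}(S)=\mathrm{V}_{\mathbb{A}}(S')$ implies $\mathrm{V}_{\mathbb{B}}(S_{\Gamma,\bar p,\gamma})=\mathrm{V}_{\mathbb{B}}(S'_{\Gamma,\bar p,\gamma})$; (F3) if $E$ induces a formula equivalence on $X\ne\emptyset$, then $E_{\Gamma,\bar p,\gamma}$ induces a formula equivalence on $\bar X$; (F4) if $E,E'$ induce the same formula equivalence on $X$, then so do $E_{\Gamma,\bar p,\gamma},E'_{\Gamma,\bar p,\gamma}$ on $\bar X$; (F5) if $\varphi$ induces a formula map $X/{\sim_X}\to Y/{\sim_Y}$, then $\varphi_{\Gamma,\bar p,\gamma}$ induces a formula map $\bar X/{\sim_{\bar X}}\to\bar Y/{\sim_{\bar Y}}$, where $\sim_{\bar X},\sim_{\bar Y}$ are induced by the translations of formulas inducing $\sim_X,\sim_Y$; (F6) if $\varphi,\varphi'$ induce the same formula map, then so do $\varphi_{\Gamma,\bar p,\gamma},\varphi'_{\Gamma,\bar p,\gamma}$; (F7) if $\varphi_{XY},\varphi_{YZ}$ induce formula maps $X/{\sim_X}\to Y/{\sim_Y}$, $Y/{\sim_Y}\to Z/{\sim_Z}$,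 then the composition of the formula maps induced by their translations is induced by the translation of $\exists\bar y(\varphi_{XY}(\bar x,\bar y)\wedge\varphi_{YZ}(\bar y,\bar z))$. If (F1)–(F7) hold, the interpretation $(\Gamma,\bar p,\gamma)$-functor $\mathcal{F}=\mathcal{F}_{\Gamma,\bar p,\gamma}\colon\mathcal{PLS}(\mathbb{A})\to\mathcal{PLS}(\mathbb{B})$ is defined by $\mathcal{F}(\emptyset)=\emptyset$, $\mathcal{F}(X/{\sim_X})=\bar X/{\sim_{\bar X}}$, $\mathcal{F}(\emptyset\to O)=(\emptyset\to\mathcal{F}(O))$, and $\mathcal{F}$ sends the formula map induced by $\varphi$ to the one induced by $\varphi_{\Gamma,\bar p,\gamma}$. Functors of this form are the interpretation functors. **Composition.** For codes $\Gamma\colon L(\mathbb{A})\to L(\mathbb{B})$ and $\Delta\colon L(\mathbb{B})\to L(\mathbb{C})$, the code $\Gamma\circ\Delta\colon L(\mathbb{A})\to L(\mathbb{C})$ consists of the $\Delta$-translations $(U_\Gamma)_\Delta,(E_\Gamma)_\Delta,(c_\Gamma)_\Delta,(f_\Gamma)_\Delta,(R_\Gamma)_\Delta$; $\dim\Gamma\circ\Delta=\dim\Gamma\cdot\dim\Delta$, $\dim_{\mathrm{par}}\Gamma\circ\Delta=\dim_{\mathrm{par}}\Gamma\cdot\dim\Delta+\dim_{\mathrm{par}}\Delta$. The composition of interpretations $(\Gamma,\bar p,\mu_\Gamma)\colon\mathbb{A}\rightsquigarrow\mathbb{B}$ and $(\Delta,\bar q,\mu_\Delta)\colon\mathbb{B}\rightsquigarrow\mathbb{C}$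 is the interpretation $(\Gamma\circ\Delta,(\bar{\bar p},\bar q),\mu_\Gamma\circ\mu_\Delta)\colon\mathbb{A}\rightsquigarrow\mathbb{C}$, where $\bar{\bar p}\in\mu_\Delta^{-1}(\bar p)$ (any choice). The identical interpretation of $\mathbb{A}$ in $\mathbb{A}$ is $(\mathbf{Id}_{L(\mathbb{A})},\emptyset,\mathrm{id}_A)$, where $\mathbf{Id}_{L(\mathbb{A})}$ has dimension 1, no parameters, $U$ is $x=x$, $E$ is $x=x'$, and symbols are coded by $x=c$, $f(x_1,\ldots,x_{n_f})=x_0$, $R(x_1,\ldots,x_{n_R})$. **The categories.** Interpretations $(\Gamma_1,\bar p_1,\mu_{\Gamma_1}),(\Gamma_2,\bar p_2,\mu_{\Gamma_2})\colon\mathbb{A}\rightsquigarrow\mathbb{B}$ are equal if $\Gamma_1(\mathbb{B},\bar p_1)=\Gamma_2(\mathbb{B},\bar p_2)$ and $\mu_{\Gamma_1}=\mu_{\Gamma_2}$. $\mathbf{AS}$: objects are all algebraic structures; morphisms $\mathbb{A}\to\mathbb{B}$ are interpretations $\mathbb{A}\rightsquigarrow\mathbb{B}$ up to equality, with composition of interpretations and identities the identical interpretations. $\mathbf{PLG}$: objects are the categories $\mathcal{PLS}(\mathbb{A})$, one for each algebraic structure $\mathbb{A}$ (indexed by $\mathbb{A}$); morphisms are the interpretation functors, with composition of functors. *)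

(* Defs.v *)
From mathcomp Require Import all_boot.
From mathcomp Require Import boolp classical_sets.

Set Implicit Arguments.
Unset Strict Implicit.
Unset Printing Implicit Defensive.

Local Open Scope classical_set_scope.

Record language := Language {
  csym : Type;
  fsym : Type;
  rsym : Type;
  farity : fsym -> nat;
  rarity : rsym -> nat }.

Arguments farity {_} _.
Arguments rarity {_} _.

(* The n-tuples of elements of [A] *)
Definition tup (A : Type) (n : nat) := 'I_n -> A.

Record model (L : language) := Model {
  carrier :> Type;
  carrier_inhabited : inhabited carrier;
  cinterp : csym L -> carrier;
  finterp : forall f : fsym L, tup carrier (farity f) -> carrier;
  rinterp : forall r : rsym L, tup carrier (rarity r) -> Prop }.

Arguments cinterp {_} _ _.
Arguments finterp {_} _ _ _.
Arguments rinterp {_} _ _ _.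

Record structure := Structure {
  lang : language;
  smodel :> model lang }.

Inductive term (L : language) (V : Type) : Type :=
| Var of V
| Cst of csym L
| App (f : fsym L) of ('I_(farity f) -> term L V).

Arguments Var {L V} _.
Arguments Cst {L V} _.
Arguments App {L V} _ _.

(* The free variables of a [formula L V] are among the elements of [V]; the
   variable bound by a quantifier is the [None] of [option V]. *)
Inductive formula (L : language) (V : Type) : Type :=
| Eq of term L V & term L V
| Rel (r : rsym L) of ('I_(rarity r) -> term L V)
| Not of formula L V
| And of formula L V & formula L V
| Or of formula L V & formula L V
| Imp of formula L V & formula L V
| Ex of formula L (option V)
| All of formula L (option V).

Arguments Rel {L V} _ _.

Definition push (V M : Type) (e : V -> M) (a : M) : option V -> M :=
  fun o => if o is Some v then e v else a.

Definition join (V W M : Type) (e : V -> M) (e' : W -> M) : V + W -> M :=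
  fun x => match x with inl v => e v | inr w => e' w end.

Fixpoint eval (L : language) (M : model L) (V : Type) (e : V -> M)
    (t : term L V) : M :=
  match t with
  | Var v => e v
  | Cst c => cinterp M c
  | App f ts => finterp M f (fun i => eval e (ts i))
  end.

Fixpoint sat (L : language) (M : model L) (V : Type) (e : V -> M)
    (phi : formula L V) {struct phi} : Prop :=
  match phi with
  | Eq t u => eval e t = eval e u
  | Rel r ts => rinterp M r (fun i => eval e (ts i))
  | Not phi => ~ sat e phi
  | And phi psi => sat e phi /\ sat e psi
  | Or phi psi => sat e phi \/ sat e psi
  | Imp phi psi => sat e phi -> sat e psi
  | Ex phi => exists a, sat (push e a) phi
  | All phi => forall a, sat (push e a) phi
  end.

Definition lequiv (L : language) (V : Type) (phi psi : formula L V) : Prop :=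
  forall (M : model L) (e : V -> M), sat e phi <-> sat e psi.

Fixpoint trename (L : language) (V W : Type) (s : V -> W) (t : term L V) :
    term L W :=
  match t with
  | Var v => Var (s v)
  | Cst c => Cst c
  | App f ts => App f (fun i => trename s (ts i))
  end.

Fixpoint rename (L : language) (V W : Type) (s : V -> W) (phi : formula L V)
    {struct phi} : formula L W :=
  match phi with
  | Eq t u => Eq (trename s t) (trename s u)
  | Rel r ts => Rel r (fun i => trename s (ts i))
  | Not phi => Not (rename s phi)
  | And phi psi => And (rename s phi) (rename s psi)
  | Or phi psi => Or (rename s phi) (rename s psi)
  | Imp phi psi => Imp (rename s phi) (rename s psi)
  | Ex phi => Ex (rename (omap s) phi)
  | All phi => All (rename (omap s) phi)
  end.

(* [blockq Q phi] quantifies the [n] variables of [phi] indexed by ['I_n] by the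
   quantifier [Q] (to be taken as [Ex] or [All]). *)
Definition bshift (V : Type) (n : nat) (x : V + 'I_n.+1) : option V + 'I_n :=
  match x with
  | inl v => inl (Some v)
  | inr i => if unlift ord0 i is Some j then inr j else inl None
  end.

Definition ord0_elim (T : Type) (i : 'I_0) : T := False_rect T (notF (ltn_ord i)).

Definition bvoid (V : Type) (x : V + 'I_0) : V :=
  match x with inl v => v | inr i => ord0_elim V i end.

Fixpoint blockq (L : language)
    (Q : forall V : Type, formula L (option V) -> formula L V)
    (V : Type) (n : nat) : formula L (V + 'I_n) -> formula L V :=
  match n return formula L (V + 'I_n) -> formula L V with
  | 0 => rename (@bvoid V)
  | n'.+1 => fun phi => Q V (blockq Q (rename (@bshift V n') phi))
  end.

Inductive unnested (L : language) (V : Type) : Type :=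
| UEq of V & V
| UCst of V & csym L
| UFun (f : fsym L) of ('I_(farity f) -> V) & V
| URel (r : rsym L) of ('I_(rarity r) -> V).

Arguments UEq {L V} _ _.
Arguments UCst {L V} _ _.
Arguments UFun {L V} _ _ _.
Arguments URel {L V} _ _.

Definition unnested_formula L V (a : unnested L V) : formula L V :=
  match a with
  | UEq x x' => Eq (Var x) (Var x')
  | UCst x c => Eq (Var x) (Cst c)
  | UFun f xs x0 => Eq (App f (fun i => Var (xs i))) (Var x0)
  | URel r xs => Rel r (fun i => Var (xs i))
  end.

(* A literal [(true, a)] is [a], a literal [(false, a)] is its negation. *)
Definition literal L V := (bool * unnested L V)%type.

Definition signed L V (b : bool) (phi : formula L V) : formula L V :=
  if b then phi else Not phi.

Inductive nelist (T : Type) : Type :=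
| One of T
| More of T & nelist T.

Fixpoint fold1 (T U : Type) (op : U -> U -> U) (f : T -> U) (l : nelist T) : U :=
  match l with
  | One x => f x
  | More x l => op (f x) (fold1 op f l)
  end.

Definition dnf L V := nelist (nelist (literal L V)).

Definition dnf_formula L L' V W (atom : unnested L V -> formula L' W)
  (D : dnf L V) : formula L' W :=
  fold1 (@Or L' W) (fold1 (@And L' W) (fun l => signed l.1 (atom l.2))) D.

Inductive nform (L : language) (V : Type) : Type :=
| Matrix of dnf L V
| NEx of nform L (option V)
| NAll of nform L (option V).

Fixpoint nf_formula (L : language) (V : Type) (N : nform L V) : formula L V :=
  match N with
  | Matrix D => dnf_formula (@unnested_formula L V) D
  | NEx N => Ex (nf_formula N)
  | NAll N => All (nf_formula N)
  end.

Definition is_nf_of L V (N : nform L V) (phi : formula L V) : Prop :=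
  lequiv phi (nf_formula N).

Section Semantics.
Variables (L : language) (M : model L).

Lemma eval_trename V W (s : V -> W) (t : term L V) (e : W -> M) :
  eval e (trename s t) = eval (e \o s) t.
Proof. by elim: t => //= f ts IH; congr finterp; apply/funext. Qed.

Lemma push_omap V W (s : V -> W) (e : W -> M) a :
  push e a \o omap s = push (e \o s) a.
Proof. by apply/funext => -[]. Qed.

Lemma sat_rename V W (s : V -> W) (phi : formula L V) (e : W -> M) :
  sat e (rename s phi) <-> sat (e \o s) phi.
Proof.
elim: phi W s e => {}V.
- by move=> t u W s e /=; rewrite !eval_trename.
- move=> r ts W s e /=; rewrite (_ : (fun i => eval e _) =
    fun i => eval (e \o s) (ts i)) //.
  by apply/funext => i; rewrite eval_trename.
- by move=> phi IH W s e /=; rewrite IH.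
- by move=> phi IH psi IH' W s e /=; rewrite IH IH'.
- by move=> phi IH psi IH' W s e /=; rewrite IH IH'.
- by move=> phi IH psi IH' W s e /=; rewrite IH IH'.
- by move=> phi IH W s e /=; split=> -[a Ha]; exists a; move: Ha;
    rewrite IH push_omap.
- by move=> phi IH W s e /=; split=> Ha a; have := Ha a; rewrite IH push_omap.
Qed.

Lemma join_bvoid V (e : V -> M) (b : tup M 0) : e \o @bvoid V = join e b.
Proof. by apply/funext => -[//|[]]. Qed.

Lemma join_bshift V n (e : V -> M) a (b : tup M n) :
  join (push e a) b \o @bshift V n =
  join e (fun i => push b a (unlift ord0 i)).
Proof. by apply/funext => -[//|i] /=; case: (unlift ord0 i). Qed.

Lemma tup_uncons n (b : tup M n.+1) :
  b = fun i => push (b \o lift ord0) (b ord0) (unlift ord0 i).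
Proof. by apply/funext => i; case: unliftP => [j ->|->]. Qed.

Lemma sat_blockEx V n (phi : formula L (V + 'I_n)) (e : V -> M) :
  sat e (blockq (@Ex L) phi) <-> exists b : tup M n, sat (join e b) phi.
Proof.
elim: n V phi e => [|n IH] V phi e /=.
  rewrite sat_rename; split=> [H|[b]]; last by rewrite -join_bvoid.
  by exists (@ord0_elim M); rewrite -join_bvoid.
split=> [[a]|[b]].
  rewrite IH => -[b]; rewrite sat_rename join_bshift => H.
  by exists (fun i => push b a (unlift ord0 i)).
rewrite [b]tup_uncons => H; exists (b ord0); rewrite IH.
by exists (b \o lift ord0); rewrite sat_rename join_bshift.
Qed.

Lemma sat_blockAll V n (phi : formula L (V + 'I_n)) (e : V -> M) :
  sat e (blockq (@All L) phi) <-> forall b : tup M n, sat (join e b) phi.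
Proof.
elim: n V phi e => [|n IH] V phi e /=.
  rewrite sat_rename; split=> [H b|]; first by rewrite -join_bvoid.
  move/(_ (@ord0_elim M)).
  by rewrite -join_bvoid.
split=> [H b|H a].
  have := H (b ord0); rewrite IH => /(_ (b \o lift ord0)).
  by rewrite sat_rename join_bshift -tup_uncons.
by rewrite IH => b; rewrite sat_rename join_bshift.
Qed.

Lemma sat_foldAnd V (T : eqType) (s : seq T) (f : T -> formula L V) psi
    (e : V -> M) :
  sat e (foldr (fun i phi => And (f i) phi) psi s) <->
  (forall i, i \in s -> sat e (f i)) /\ sat e psi.
Proof.
elim: s => [|x s IH] /=; first by split=> [|[]].
rewrite IH; split=> [[Hx [Hs Hp]]|[Hs Hp]].
  by split=> // i; rewrite inE => /orP[/eqP->//|]; apply: Hs.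
split; first by apply: Hs; rewrite mem_head.
by split=> // i Hi; apply: Hs; rewrite inE Hi orbT.
Qed.

Lemma sat_signed V b (phi : formula L V) (e : V -> M) :
  sat e (signed b phi) <-> (if b then sat e phi else ~ sat e phi).
Proof. by case: b. Qed.

Lemma sat_fold1Or V T (f : T -> formula L V) l (e : V -> M) :
  sat e (fold1 (@Or L V) f l) <-> fold1 or (fun x => sat e (f x)) l.
Proof. by elim: l => //= x l ->. Qed.

Lemma sat_fold1And V T (f : T -> formula L V) l (e : V -> M) :
  sat e (fold1 (@And L V) f l) <-> fold1 and (fun x => sat e (f x)) l.
Proof. by elim: l => //= x l ->. Qed.

End Semantics.

Lemma fold1_iff T (op : Prop -> Prop -> Prop) (f g : T -> Prop) l :
  (forall x, f x <-> g x) -> fold1 op f l <-> fold1 op g l.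
Proof. by move=> fg; rewrite (_ : f = g) //; apply/funext => x; apply/propext. Qed.

Fixpoint nelist_map T U (f : T -> U) (l : nelist T) : nelist U :=
  match l with One x => One (f x) | More x l => More (f x) (nelist_map f l) end.

Fixpoint nelist_app T (l l' : nelist T) : nelist T :=
  match l with One x => More x l' | More x l => More x (nelist_app l l') end.

Lemma fold1_map T U Z (op : Z -> Z -> Z) (f : U -> Z) (g : T -> U) l :
  fold1 op f (nelist_map g l) = fold1 op (f \o g) l.
Proof. by elim: l => //= x l ->. Qed.

Lemma fold1_or_app T (f : T -> Prop) l l' :
  fold1 or f (nelist_app l l') <-> fold1 or f l \/ fold1 or f l'.
Proof. by elim: l => //= x l ->; rewrite or_assoc. Qed.

Lemma fold1_and_app T (f : T -> Prop) l l' :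
  fold1 and f (nelist_app l l') <-> fold1 and f l /\ fold1 and f l'.
Proof. by elim: l => //= x l ->; rewrite and_assoc. Qed.

Definition unnested_rename L V W (s : V -> W) (a : unnested L V) : unnested L W :=
  match a with
  | UEq x x' => UEq (s x) (s x')
  | UCst x c => UCst (s x) c
  | UFun f xs x0 => UFun f (fun i => s (xs i)) (s x0)
  | URel r xs => URel r (fun i => s (xs i))
  end.

Fixpoint nform_rename L V W (s : V -> W) (N : nform L V) : nform L W :=
  match N with
  | Matrix D => Matrix (nelist_map
      (nelist_map (fun l => (l.1, unnested_rename s l.2))) D)
  | NEx N => NEx (nform_rename (omap s) N)
  | NAll N => NAll (nform_rename (omap s) N)
  end.

Definition dsat L L' (M : model L') V W (e : W -> M)
    (atom : unnested L V -> formula L' W) (D : dnf L V) : Prop :=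
  fold1 or (fold1 and (fun l => sat e (signed l.1 (atom l.2)))) D.

Lemma sat_dnf L L' (M : model L') V W (e : W -> M)
    (atom : unnested L V -> formula L' W) D :
  sat e (dnf_formula atom D) <-> dsat e atom D.
Proof.
rewrite /dnf_formula sat_fold1Or; apply: fold1_iff => C.
exact: sat_fold1And.
Qed.

Section NormalForms.
Variable L : language.

Lemma sat_unnested_rename (M : model L) V W (s : V -> W) (a : unnested L V)
    (e : W -> M) :
  sat e (unnested_formula (unnested_rename s a)) <->
  sat (e \o s) (unnested_formula a).
Proof. by case: a. Qed.

Lemma sat_nform_rename (M : model L) V W (s : V -> W) (N : nform L V) (e : W -> M) :
  sat e (nf_formula (nform_rename s N)) <-> sat (e \o s) (nf_formula N).
Proof.
elim: N W s e => {}V.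
- move=> D W s e; rewrite /= !sat_dnf /dsat fold1_map.
  apply: fold1_iff => C; rewrite /= fold1_map; apply: fold1_iff => -[b a] /=.
  by rewrite !sat_signed; case: b; rewrite sat_unnested_rename.
- by move=> N IH W s e /=; split=> -[a Ha]; exists a; move: Ha;
    rewrite IH push_omap.
- by move=> N IH W s e /=; split=> Ha a; have := Ha a; rewrite IH push_omap.
Qed.

Definition has_nf V (phi : formula L V) := exists N : nform L V, is_nf_of N phi.

Lemma has_nf_equiv V (phi psi : formula L V) :
  lequiv phi psi -> has_nf phi -> has_nf psi.
Proof. by move=> pq [N HN]; exists N => M e; rewrite -(pq M e). Qed.

Lemma dnf_or V (D D' : dnf L V) : has_nf (Or (nf_formula (Matrix D)) (nf_formula (Matrix D'))).
Proof.
by exists (Matrix (nelist_app D D')) => M e /=; rewrite !sat_dnf /dsat fold1_or_app.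
Qed.

Lemma dnf_and V (D D' : dnf L V) :
  exists D2 : dnf L V, lequiv (And (nf_formula (Matrix D)) (nf_formula (Matrix D')))
     (nf_formula (Matrix D2)).
Proof.
have one C : exists D2 : dnf L V,
    lequiv (And (nf_formula (Matrix (One C))) (nf_formula (Matrix D')))
           (nf_formula (Matrix D2)).
  exists (nelist_map (nelist_app C) D') => M e /=; rewrite !sat_dnf /dsat fold1_map /=.
  elim: D' => [C'|C' D' IH] /=.
    by rewrite fold1_and_app.
  by rewrite -IH fold1_and_app; tauto.
elim: D => [C|C D [D2 H2]]; first exact: one.
have [D1 H1] := one C; exists (nelist_app D1 D2) => M e.
have := H1 M e; have := H2 M e => /=; rewrite !sat_dnf /dsat fold1_or_app /=.
by move=> <- <-; tauto.
Qed.

Lemma nf_and_matrix V (N : nform L V) (D : dnf L V) :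
  exists N', lequiv (And (nf_formula N) (nf_formula (Matrix D))) (nf_formula N').
Proof.
elim: N D => {}V.
- by move=> D D'; have [D2 H2] := dnf_and D D'; exists (Matrix D2).
- move=> N IH D; have [N' H'] := IH
    (nelist_map (nelist_map (fun l => (l.1, unnested_rename Some l.2))) D).
  exists (NEx N') => M e /=.
  have HD a : sat e (dnf_formula (@unnested_formula L V) D) <->
      sat (push e a) (nf_formula (nform_rename Some (Matrix D))).
    by rewrite sat_nform_rename.
  split=> [[[a Ha] Hd]|[a]].
    by exists a; apply/H'; split=> //; apply/HD.
  by case/H'=> Ha /HD Hd; split=> //; exists a.
- move=> N IH D; have [N' H'] := IH
    (nelist_map (nelist_map (fun l => (l.1, unnested_rename Some l.2))) D).
  exists (NAll N') => M e /=.
  have HD a : sat e (dnf_formula (@unnested_formula L V) D) <->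
      sat (push e a) (nf_formula (nform_rename Some (Matrix D))).
    by rewrite sat_nform_rename.
  split=> [[Ha Hd] a|H].
    by apply/H'; split=> //; apply/HD.
  split=> [a|]; first by have /H'[] := H a.
  by have [a] := carrier_inhabited M; have /H'[_ /HD] := H a.
Qed.

Lemma has_nf_and V (phi psi : formula L V) :
  has_nf phi -> has_nf psi -> has_nf (And phi psi).
Proof.
move=> [N HN] [N2 HN2].
suff [N' H'] : exists N', lequiv (And (nf_formula N) (nf_formula N2)) (nf_formula N').
  by exists N' => M e /=; rewrite -(H' M e) /= (HN M e) (HN2 M e).
elim: N2 N {phi psi HN HN2} => {}V.
- by move=> D N; apply: nf_and_matrix.
- move=> N2 IH N; have [N' H'] := IH (nform_rename Some N).
  exists (NEx N') => M e /=.
  have HD a : sat e (nf_formula N) <->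
      sat (push e a) (nf_formula (nform_rename Some N)).
    by rewrite sat_nform_rename.
  split=> [[Hd [a Ha]]|[a]].
    by exists a; apply/H'; split=> //; apply/HD.
  by case/H'=> /HD Hd Ha; split=> //; exists a.
- move=> N2 IH N; have [N' H'] := IH (nform_rename Some N).
  exists (NAll N') => M e /=.
  have HD a : sat e (nf_formula N) <->
      sat (push e a) (nf_formula (nform_rename Some N)).
    by rewrite sat_nform_rename.
  split=> [[Hd Ha] a|H].
    by apply/H'; split=> //; apply/HD.
  split=> [|a]; last by have /H'[] := H a.
  by have [a] := carrier_inhabited M; have /H'[/HD] := H a.
Qed.

Lemma dnf_not_conj V (C : nelist (literal L V)) :
  exists D : dnf L V,
    lequiv (Not (nf_formula (Matrix (One C)))) (nf_formula (Matrix D)).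
Proof.
elim: C => [[b a]|[b a] C [D HD]].
  exists (One (One (~~ b, a))) => M e; rewrite /= /dnf_formula /=.
  by case: b => //=; rewrite notK.
exists (More (One (~~ b, a)) D) => M e; have := HD M e.
rewrite /= /dnf_formula /= => <-; rewrite not_andE.
by case: b => /=; rewrite ?notK.
Qed.

Lemma has_nf_not V (phi : formula L V) : has_nf phi -> has_nf (Not phi).
Proof.
move=> [N HN].
suff [N' H'] : has_nf (Not (nf_formula N)).
  by exists N' => M e /=; rewrite -(H' M e) /= (HN M e).
elim: N {phi HN} => {}V.
- move=> D; suff [D' H'] : exists D' : dnf L V,
    lequiv (Not (nf_formula (Matrix D))) (nf_formula (Matrix D')) by exists (Matrix D').
  elim: D => [C|C D [D1 H1]]; first exact: dnf_not_conj.
  have [D2 H2] := dnf_not_conj C; have [D3 H3] := dnf_and D2 D1.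
  exists D3 => M e; have := H3 M e; rewrite /= => <-.
  have := H1 M e; rewrite /= => <-; have := H2 M e; rewrite /= => <-.
  by rewrite /dnf_formula /= not_orE.
- move=> N [N' H']; exists (NAll N') => M e /=.
  split=> [H a|H [a Ha]].
    by apply/H' => /= Ha; apply: H; exists a.
  by have /H' := H a.
- move=> N [N' H']; exists (NEx N') => M e /=.
  split=> [/existsNP[a Ha]|[a /H' Ha] /(_ a)//].
  by exists a; apply/H'.
Qed.

Lemma has_nf_or V (phi psi : formula L V) :
  has_nf phi -> has_nf psi -> has_nf (Or phi psi).
Proof.
move=> Hphi Hpsi.
apply: has_nf_equiv (has_nf_not (has_nf_and (has_nf_not Hphi) (has_nf_not Hpsi))).
by move=> M e /=; rewrite not_andE !notK.
Qed.

Lemma has_nf_imp V (phi psi : formula L V) :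
  has_nf phi -> has_nf psi -> has_nf (Imp phi psi).
Proof.
move=> Hphi Hpsi; apply: has_nf_equiv (has_nf_or (has_nf_not Hphi) Hpsi).
by move=> M e /=; rewrite implyE.
Qed.

Lemma has_nf_Ex V (phi : formula L (option V)) : has_nf phi -> has_nf (Ex phi).
Proof.
by move=> [N HN]; exists (NEx N) => M e /=; split=> -[a /HN Ha]; exists a.
Qed.

Lemma has_nf_All V (phi : formula L (option V)) : has_nf phi -> has_nf (All phi).
Proof.
by move=> [N HN]; exists (NAll N) => M e /=; split=> H a; apply/HN.
Qed.

Lemma has_nf_unnested V (a : unnested L V) : has_nf (unnested_formula a).
Proof. by exists (Matrix (One (One (true, a)))). Qed.

Lemma has_nf_rename V W (s : V -> W) phi : has_nf phi -> has_nf (rename s phi).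
Proof.
move=> [N HN]; exists (nform_rename s N) => M e.
by rewrite sat_nform_rename sat_rename.
Qed.

Lemma has_nf_blockEx V n (phi : formula L (V + 'I_n)) :
  has_nf phi -> has_nf (blockq (@Ex L) phi).
Proof.
elim: n V phi => [|n IH] V phi H /=; first exact: has_nf_rename.
by apply/has_nf_Ex/IH/has_nf_rename.
Qed.

Lemma has_nf_foldAnd V (T : eqType) (s : seq T) (f : T -> formula L V) psi :
  (forall i, has_nf (f i)) -> has_nf psi ->
  has_nf (foldr (fun i phi => And (f i) phi) psi s).
Proof. by move=> Hf Hp; elim: s => //= x s; apply: has_nf_and. Qed.

Lemma tup_exists_eq (M : Type) n (c : tup M n) (P : tup M n -> Prop) :
  P c <-> exists b : tup M n, (forall i, c i = b i) /\ P b.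
Proof.
by split=> [H|[b [/funext -> //]]]; exists c.
Qed.

Lemma has_nf_term V W (t : term L V) (s : V -> W) x :
  has_nf (Eq (trename s t) (Var x)).
Proof.
elim: t W s x => [v|c|f ts IH] W s x.
- exact: (has_nf_unnested (UEq (s v) x)).
- apply: has_nf_equiv (has_nf_unnested (UCst x c)) => M e /=.
  by split=> ->.
- pose ats := blockq (@Ex L) (foldr (fun i phi =>
    And (Eq (trename (inl \o s) (ts i)) (Var (inr i))) phi)
    (unnested_formula (UFun f (fun i : 'I_(farity f) => inr i) (inl x)))
    (enum 'I_(farity f))).
  apply: (@has_nf_equiv _ ats).
    move=> M e; rewrite sat_blockEx /=.
    rewrite (tup_exists_eq _ (fun b => finterp M f b = e x)).
    split=> -[b Hb]; exists b; move: Hb; rewrite sat_foldAnd /=.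
      move=> [Hb ->]; split=> // i; move: (Hb i (mem_enum _ i)).
      by rewrite !eval_trename.
    move=> [Hb Hx]; split=> // i _; move: (Hb i).
    by rewrite !eval_trename.
  apply/has_nf_blockEx/has_nf_foldAnd => [i|]; first exact: IH.
  exact: has_nf_unnested.
Qed.

Lemma has_nfP V (phi : formula L V) : has_nf phi.
Proof.
elim: phi => {}V.
- move=> t u.
  apply: (@has_nf_equiv _ (Ex (And (Eq (trename Some t) (Var None))
     (Eq (trename Some u) (Var None))))).
    move=> M e /=; split=> [[a]|E].
      by rewrite !eval_trename => -[-> ->].
    by exists (eval e t); rewrite !eval_trename E.
  by apply/has_nf_Ex/has_nf_and; apply: has_nf_term.
- move=> r ts.
  pose ats := blockq (@Ex L) (foldr (fun i phi =>
    And (Eq (trename inl (ts i)) (Var (inr i))) phi)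
    (unnested_formula (URel r (fun i : 'I_(rarity r) => inr i)))
    (enum 'I_(rarity r))).
  apply: (@has_nf_equiv _ ats).
    move=> M e; rewrite sat_blockEx /=.
    rewrite (tup_exists_eq _ (fun b => rinterp M r b)).
    split=> -[b Hb]; exists b; move: Hb; rewrite sat_foldAnd /=.
      move=> [Hb Hr]; split=> // i; move: (Hb i (mem_enum _ i)).
      by rewrite !eval_trename.
    move=> [Hb Hx]; split=> // i _; move: (Hb i).
    by rewrite !eval_trename.
  apply/has_nf_blockEx/has_nf_foldAnd => [i|]; first exact: has_nf_term.
  exact: has_nf_unnested.
- by move=> phi; apply: has_nf_not.
- by move=> phi IH psi; apply: has_nf_and.
- by move=> phi IH psi; apply: has_nf_or.
- by move=> phi IH psi; apply: has_nf_imp.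
- by move=> phi; apply: has_nf_Ex.
- by move=> phi; apply: has_nf_All.
Qed.

End NormalForms.

Definition nf L V (phi : formula L V) : nform L V := sval (cid (has_nfP phi)).

Lemma nfP L V (phi : formula L V) : is_nf_of (nf phi) phi.
Proof. exact: svalP (cid (has_nfP phi)). Qed.

(* [c_Gamma], [U_Gamma] have one block of variables, [E_Gamma] has two (the
   second one being indexed by [true]); in [f_Gamma] the block [None] is the
   value x_0 and the blocks [Some i] are the arguments. *)
Record code (L L' : language) := Code {
  dim : nat;
  pdim : nat;
  codeU : formula L' (unit * 'I_dim + 'I_pdim);
  codeE : formula L' (bool * 'I_dim + 'I_pdim);
  codec : csym L -> formula L' (unit * 'I_dim + 'I_pdim);
  codef : forall f : fsym L, formula L' (option 'I_(farity f) * 'I_dim + 'I_pdim);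
  coder : forall r : rsym L, formula L' ('I_(rarity r) * 'I_dim + 'I_pdim) }.

(* The assignment of the blocks [b v] to the block variables and of [p] to the
   parameters. *)
Definition blocks (V M : Type) (d q : nat) (b : V -> tup M d) (p : tup M q) :
    V * 'I_d + 'I_q -> M :=
  join (fun x => b x.1 x.2) p.

(* Elements of the quotient of [X] by [R] are the equivalence classes. *)
Definition quot (T : Type) (X : set T) (R : T -> T -> Prop) : Type :=
  {C : set T | exists2 a, X a & C = [set b | X b /\ R a b]}.

Definition cls (T : Type) (X : set T) (R : T -> T -> Prop) (a : {a | X a}) :
    quot X R :=
  exist _ [set b | X b /\ R (sval a) b] (ex_intro2 _ _ (sval a) (svalP a) erefl).

Arguments cls {T} X R a.

Definition equiv_on (T : Type) (X : set T) (R : T -> T -> Prop) : Prop :=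
  [/\ forall a, X a -> R a a,
      forall a b, X a -> X b -> R a b -> R b a
    & forall a b c, X a -> X b -> X c -> R a b -> R b c -> R a c].

Section CodedStructure.
Variables (L L' : language) (G : code L L') (B : model L') (p : tup B (pdim G)).

Definition defU : set (tup B (dim G)) :=
  [set b | sat (blocks (fun _ => b) p) (codeU G)].

Definition defE (b b' : tup B (dim G)) : Prop :=
  sat (blocks (fun i : bool => if i then b' else b) p) (codeE G).

Definition defc (c : csym L) : set (tup B (dim G)) :=
  [set b | sat (blocks (fun _ => b) p) (codec G c)].

Definition deff (f : fsym L) (b0 : tup B (dim G))
    (bs : 'I_(farity f) -> tup B (dim G)) : Prop :=
  sat (blocks (push bs b0) p) (codef G f).

Definition defr (r : rsym L) (bs : 'I_(rarity r) -> tup B (dim G)) : Prop :=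
  sat (blocks bs p) (coder G r).

Record well_defined : Prop := WellDefined {
  wd_nonempty : defU !=set0;
  wd_equiv : equiv_on defU defE;
  wd_c : forall c, exists2 b, defU b &
    forall b', defU b' -> (defc c b' <-> defE b b');
  wd_f_congr : forall f b0 b0' bs bs',
    defU b0 -> defU b0' -> (forall i, defU (bs i)) -> (forall i, defU (bs' i)) ->
    defE b0 b0' -> (forall i, defE (bs i) (bs' i)) ->
    @deff f b0 bs -> @deff f b0' bs';
  wd_f_fun : forall f bs, (forall i, defU (bs i)) ->
    exists2 b0, defU b0 & forall b0', defU b0' -> (@deff f b0' bs <-> defE b0 b0');
  wd_r_congr : forall r bs bs',
    (forall i, defU (bs i)) -> (forall i, defU (bs' i)) ->
    (forall i, defE (bs i) (bs' i)) -> @defr r bs -> @defr r bs' }.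

Hypothesis wd : well_defined.

Lemma coded_c_subproof c :
  exists2 b, defU b & [set b' | defU b' /\ defc c b'] = [set b' | defU b' /\ defE b b'].
Proof.
have [b Ub Hb] := wd_c wd c; exists b => //.
by apply/seteqP; split=> b' /= [Ub' Hb']; split=> //; apply/Hb.
Qed.

Lemma coded_f_subproof f (Cs : 'I_(farity f) -> quot defU defE) :
  exists2 b, defU b &
    [set b0 | defU b0 /\ exists2 bs, (forall i, sval (Cs i) (bs i)) & deff b0 bs]
    = [set b0 | defU b0 /\ defE b b0].
Proof.
have [rE sE tE] := wd_equiv wd.
have /choice[bs Hbs] i : exists b, sval (Cs i) b.
  by case: (Cs i) => C /= [b Ub ->]; exists b; split=> //; apply: rE.
have inC i b b' : sval (Cs i) b -> sval (Cs i) b' ->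
    [/\ defU b, defU b' & defE b b'].
  case: (Cs i) => C /= [b1 Ub1 ->] [Ub Eb] [Ub' Eb']; split=> //.
  by apply: (tE _ b1) => //; apply: sE.
have Ubs i : defU (bs i) by have [] := inC i _ _ (Hbs i) (Hbs i).
have [b Ub Hb] := wd_f_fun wd Ubs; exists b => //.
apply/seteqP; split=> b0 /= [Ub0].
  move=> [bs' Hbs' Hf]; split=> //; apply/Hb => //.
  apply: (wd_f_congr wd) Hf => // [i||i].
  - by have [] := inC i _ _ (Hbs' i) (Hbs' i).
  - exact: rE.
  - by have [] := inC i _ _ (Hbs' i) (Hbs i).
by move=> Eb; split=> //; exists bs => //; apply/Hb.
Qed.

Lemma coded_inhabited : inhabited (quot defU defE).
Proof. by have [b Ub] := wd_nonempty wd; exists; apply: (cls _ _ (exist _ b Ub)). Qed.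

Definition coded_model : model L :=
  @Model L (quot defU defE) coded_inhabited
    (fun c => exist _ _ (coded_c_subproof c))
    (fun f Cs => exist _ _ (coded_f_subproof Cs))
    (fun r Cs => exists2 bs, (forall i, sval (Cs i) (bs i)) & defr bs).

End CodedStructure.

Arguments defU {L L'} G B p _.
Arguments defE {L L'} G B p _ _.
Arguments defc {L L'} G B p c _.
Arguments deff {L L'} G B p f _ _.
Arguments defr {L L'} G B p r _.
Arguments well_defined {L L'} G B p.

Definition is_isomorphism (L : language) (M N : model L) (h : M -> N) : Prop :=
  [/\ bijective h,
      forall c, h (cinterp M c) = cinterp N c,
      forall f (xs : tup M (farity f)), h (finterp M f xs) = finterp N f (h \o xs)
    & forall r (xs : tup M (rarity r)), rinterp M r xs <-> rinterp N r (h \o xs)].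

Record interpretation (A B : structure) := Interpretation {
  icode : code (lang A) (lang B);
  ipar : tup B (pdim icode);
  iwd : well_defined icode B ipar;
  icoord : {b | defU icode B ipar b} -> A;
  icoord_surj : forall a, exists b, icoord b = a;
  icoord_iso : exists2 h : coded_model iwd -> A,
    is_isomorphism h & forall b, h (cls _ _ b) = icoord b }.

Arguments ipar {A B} _.
Arguments icoord {A B} _ _.

Definition tcast (M : Type) (d d' : nat) (e : d = d') (b : tup M d) : tup M d' :=
  fun i => b (cast_ord (esym e) i).

(* Equality of the two structures [Gamma_i(B, p_i)] (same set of tuples, same
   classes, same constants, functions and relations on the classes) and of the
   two coordinate maps. *)
Definition interp_eq (A B : structure) (i j : interpretation A B) : Prop :=
  exists e : dim (icode i) = dim (icode j),
    let Ui := defU (icode i) B (ipar i) in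
    let Uj := defU (icode j) B (ipar j) in
    [/\ forall b, Ui b <-> Uj (tcast e b),
        forall b b', Ui b -> Ui b' ->
          (defE (icode i) B (ipar i) b b' <->
           defE (icode j) B (ipar j) (tcast e b) (tcast e b')),
       [/\ forall c b, Ui b ->
             (defc (icode i) B (ipar i) c b <->
              defc (icode j) B (ipar j) c (tcast e b)),
           forall f b0 bs, Ui b0 -> (forall k, Ui (bs k)) ->
             (deff (icode i) B (ipar i) f b0 bs <->
              deff (icode j) B (ipar j) f (tcast e b0) (tcast e \o bs))
         & forall r bs, (forall k, Ui (bs k)) ->
             (defr (icode i) B (ipar i) r bs <->
              defr (icode j) B (ipar j) r (tcast e \o bs))]
      & forall b b', sval b' = tcast e (sval b) -> icoord i b = icoord j b'].

Definition onblocks (V W : Type) (d q : nat) (s : V -> W) (x : V * 'I_d + 'I_q) :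
    W * 'I_d + 'I_q :=
  match x with inl (v, i) => inl (s v, i) | inr k => inr k end.

(* The block of the variable [None] becomes a tuple of ['I_d] new variables. *)
Definition unblock (V : Type) (d q : nat) (x : option V * 'I_d + 'I_q) :
    (V * 'I_d + 'I_q) + 'I_d :=
  match x with
  | inl (Some v, i) => inl (inl (v, i))
  | inl (None, i) => inr i
  | inr k => inl (inr k)
  end.

Section Translation.
Variables (L L' : language) (G : code L L').

Definition bvars (V : Type) : Type := (V * 'I_(dim G) + 'I_(pdim G))%type.

Definition in_U (V : Type) (v : V) : formula L' (bvars V) :=
  rename (onblocks (fun _ => v)) (codeU G).

Definition tr_unnested (V : Type) (a : unnested L V) : formula L' (bvars V) :=
  match a with
  | UEq x x' => rename (onblocks (fun i : bool => if i then x' else x)) (codeE G)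
  | UCst x c => rename (onblocks (fun _ => x)) (codec G c)
  | UFun f xs x0 => rename (onblocks (push xs x0)) (codef G f)
  | URel r xs => rename (onblocks xs) (coder G r)
  end.

Fixpoint tr_body (V : Type) (N : nform L V) : formula L' (bvars V) :=
  match N with
  | Matrix D => dnf_formula (@tr_unnested V) D
  | NEx N => blockq (@Ex L') (rename (@unblock V _ _) (And (in_U None) (tr_body N)))
  | NAll N => blockq (@All L') (rename (@unblock V _ _) (Imp (in_U None) (tr_body N)))
  end.

Definition translate (V : finType) (N : nform L V) : formula L' (bvars V) :=
  foldr (fun v phi => And (in_U v) phi) (tr_body N) (enum V).

End Translation.

Section Flatten.
Variables m d : nat.

Lemma flat_subproof (i : 'I_m) (j : 'I_d) : i * d + j < m * d.
Proof.
apply: (@leq_trans (i * d + d)); first by rewrite ltn_add2l.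
by rewrite -mulSnr leq_mul2r ltn_ord orbT.
Qed.

Lemma flat_row_subproof (k : 'I_(m * d)) : k %/ d < m.
Proof. by case: d k => [|d'] [k Hk] /=; [rewrite muln0 in Hk|rewrite ltn_divLR]. Qed.

Lemma flat_col_subproof (k : 'I_(m * d)) : k %% d < d.
Proof. by case: d k => [|d'] [k Hk] /=; [rewrite muln0 in Hk|rewrite ltn_pmod]. Qed.

Definition flat_index (x : 'I_m * 'I_d) : 'I_(m * d) := Ordinal (flat_subproof x.1 x.2).

Definition flat_row (k : 'I_(m * d)) : 'I_m := Ordinal (flat_row_subproof k).
Definition flat_col (k : 'I_(m * d)) : 'I_d := Ordinal (flat_col_subproof k).

(* The identification of m-tuples of d-tuples with (m * d)-tuples. *)
Definition tflat (M : Type) (b : 'I_m -> tup M d) : tup M (m * d) :=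
  fun k => b (flat_row k) (flat_col k).

Definition tunflat (M : Type) (c : tup M (m * d)) : 'I_m -> tup M d :=
  fun i j => c (flat_index (i, j)).

End Flatten.

Definition tconcat (M : Type) (m n : nat) (b : tup M m) (c : tup M n) : tup M (m + n) :=
  fun k => join b c (split k).

Lemma cls_eq T (X : set T) R (a b : {a | X a}) : equiv_on X R ->
  (cls X R a = cls X R b) <-> R (sval a) (sval b).
Proof.
case: a b => [a Xa] [b Xb] [rR sR tR] /=; split.
  by move=> /(congr1 sval)/= /seteqP[_ /(_ b)]; case=> //; split=> //; apply: rR.
move=> Rab; apply: eq_exist; apply/seteqP; split=> c /= [Xc Rc]; split=> //.
  by apply: (tR _ a) => //; apply: sR.
exact: (tR _ b).
Qed.

Lemma quotP T (X : set T) R (C : quot X R) : exists a, C = cls X R a.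
Proof. by case: C => C HC; case: (HC) => a Xa E; exists (exist _ a Xa); apply: eq_exist. Qed.

Lemma mem_cls T (X : set T) R (a : {a | X a}) (C : quot X R) : equiv_on X R ->
  sval C (sval a) <-> C = cls X R a.
Proof.
move=> eR; have [b ->] := quotP C; rewrite cls_eq // /=; split=> [[]//|].
by case: a => a Xa /=.
Qed.

Section CodedLemmas.
Variables (L L' : language) (G : code L L') (B : model L') (p : tup B (pdim G)).
Hypothesis wd : well_defined G B p.
Local Notation M := (coded_model wd).
Local Notation U := (defU G B p).
Local Notation E := (defE G B p).

Lemma coded_c_cls c b : (cinterp M c = cls U E b) <-> defc G B p c (sval b).
Proof.
rewrite -mem_cls /=; last exact: wd_equiv wd.
by split=> [[]//|]; case: b.
Qed.

Lemma coded_f_cls f (bs : 'I_(farity f) -> {b | U b}) b :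
  (finterp M f (cls U E \o bs) = cls U E b) <->
  deff G B p f (sval b) (fun k => sval (bs k)).
Proof.
have [rE sE tE] := wd_equiv wd.
rewrite -mem_cls /=; last exact: wd_equiv wd.
split=> [[Ub [bs' Hbs']]|H].
  apply: (wd_f_congr wd) => // [k|k||k]; last 1 first.
  - by have [Ub' Eb'] := Hbs' k; apply: sE => //; apply: (svalP (bs k)).
  - by have [] := Hbs' k.
  - exact: (svalP (bs k)).
  - exact: rE.
split; first exact: svalP b.
by exists (fun k => sval (bs k)) => // k; split; [|apply: rE]; apply: (svalP (bs k)).
Qed.

Lemma coded_r_cls r (bs : 'I_(rarity r) -> {b | U b}) :
  rinterp M r (cls U E \o bs) <-> defr G B p r (fun k => sval (bs k)).
Proof.
have [rE sE tE] := wd_equiv wd.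
split=> [[bs' Hbs']|H] /=.
  apply: (wd_r_congr wd) => k; last 1 first.
  - by have [Ub' Eb'] := Hbs' k; apply: sE => //; apply: (svalP (bs k)).
  - by have [] := Hbs' k.
  - exact: (svalP (bs k)).
by exists (fun k => sval (bs k)) => // k; split; [|apply: rE]; apply: (svalP (bs k)).
Qed.
End CodedLemmas.

Lemma model_nonempty L (M : model L) : exists _ : M, True.
Proof. by have [a] := carrier_inhabited M; exists a. Qed.

Section CoordinateMap.
Variables (A B : structure) (i : interpretation A B).
Local Notation G := (icode i).
Local Notation p := (ipar i).
Local Notation U := (defU G B p).

(* The coordinate map, extended arbitrarily outside its domain. *)
Definition xcoord (b : tup B (dim G)) : A :=
  match pselect (U b) with
  | left Ub => icoord i (exist _ b Ub)
  | right _ => sval (cid (model_nonempty A))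
  end.

Lemma xcoordE b (Ub : U b) : xcoord b = icoord i (exist _ b Ub).
Proof.
rewrite /xcoord; case: pselect => // Ub'.
by rewrite (Prop_irrelevance Ub' Ub).
Qed.

Lemma xcoord_sval b : xcoord (sval b) = icoord i b.
Proof. by case: b => b Ub; rewrite xcoordE. Qed.

Lemma xcoord_surj a : exists2 b, U b & xcoord b = a.
Proof.
have [[b Ub] <-] := icoord_surj i a.
by exists b => //; rewrite xcoordE.
Qed.

Lemma defE_xcoord b b' : U b -> U b' -> defE G B p b b' <-> xcoord b = xcoord b'.
Proof.
move=> Ub Ub'; rewrite !xcoordE; have [h [bij _ _ _] hE] := icoord_iso i.
rewrite -!hE -(cls_eq (exist _ b Ub) (exist _ b' Ub') (wd_equiv (iwd i))).
split=> [->//|]; exact: bij_inj bij _ _.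
Qed.

Lemma defc_xcoord c b : U b -> defc G B p c b <-> xcoord b = cinterp A c.
Proof.
move=> Ub; rewrite xcoordE; have [h [bij hc _ _] hE] := icoord_iso i.
rewrite -hE -hc -(coded_c_cls (iwd i) c (exist _ b Ub)).
split=> [->//|/(bij_inj bij)//].
Qed.

Lemma deff_xcoord f b0 bs : U b0 -> (forall k, U (bs k)) ->
  deff G B p f b0 bs <-> finterp A f (xcoord \o bs) = xcoord b0.
Proof.
move=> Ub0 Ubs; have [h [bij _ hf _] hE] := icoord_iso i.
have -> : xcoord \o bs = h \o (cls U (defE G B p) \o (fun k => exist _ (bs k) (Ubs k))).
  by apply/funext => k /=; rewrite hE xcoordE.
rewrite xcoordE -hE -hf.
rewrite -(coded_f_cls (iwd i) (fun k => exist _ (bs k) (Ubs k)) (exist _ b0 Ub0)).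
split=> [->//|/(bij_inj bij)//].
Qed.

Lemma defr_xcoord r bs : (forall k, U (bs k)) ->
  defr G B p r bs <-> rinterp A r (xcoord \o bs).
Proof.
move=> Ubs; have [h [bij _ _ hr] hE] := icoord_iso i.
have -> : xcoord \o bs = h \o (cls U (defE G B p) \o (fun k => exist _ (bs k) (Ubs k))).
  by apply/funext => k /=; rewrite hE xcoordE.
by rewrite -hr -(coded_r_cls (iwd i) (fun k => exist _ (bs k) (Ubs k))).
Qed.

End CoordinateMap.

(* Conversely, an interpretation is given by a map with the above properties. *)
Section MakeInterpretation.
Variables (A B : structure) (G : code (lang A) (lang B)) (p : tup B (pdim G)).
Local Notation U := (defU G B p).
Variable mu : tup B (dim G) -> A.
Hypothesis mu_surj : forall a, exists2 b, U b & mu b = a.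
Hypothesis muE : forall b b', U b -> U b' -> defE G B p b b' <-> mu b = mu b'.
Hypothesis muc : forall c b, U b -> defc G B p c b <-> mu b = cinterp A c.
Hypothesis muf : forall f b0 bs, U b0 -> (forall k, U (bs k)) ->
  deff G B p f b0 bs <-> finterp A f (mu \o bs) = mu b0.
Hypothesis mur : forall r bs, (forall k, U (bs k)) ->
  defr G B p r bs <-> rinterp A r (mu \o bs).

Lemma make_wd : well_defined G B p.
Proof.
have eqc (n : nat) (bs bs' : 'I_n -> tup B (dim G)) :
    (forall k, U (bs k)) -> (forall k, U (bs' k)) ->
    (forall k, defE G B p (bs k) (bs' k)) -> mu \o bs = mu \o bs'.
  by move=> Ub Ub' Eb; apply/funext => k /=; apply/muE.
split.
- by have [a _] := model_nonempty A; have [b Ub _] := mu_surj a; exists b.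
- split=> [b Ub|b b' Ub Ub'|b b' b2 Ub Ub' Ub2].
  + exact/muE.
  + by rewrite !muE.
  + by rewrite !muE // => -> ->.
- move=> c; have [b Ub Eb] := mu_surj (cinterp A c); exists b => // b' Ub'.
  by rewrite muc // muE // Eb; split=> ->.
- move=> f b0 b0' bs bs' U0 U0' Us Us' E0 Es.
  by rewrite !muf // (eqc _ _ _ Us Us' Es); move/muE: E0 => ->.
- move=> f bs Us; have [b Ub Eb] := mu_surj (finterp A f (mu \o bs)).
  by exists b => // b' Ub'; rewrite muf // muE // Eb.
- move=> r bs bs' Us Us' Es.
  by rewrite !mur // (eqc _ _ _ Us Us' Es).
Qed.

Lemma make_surj a : exists b : {b | U b}, mu (sval b) = a.
Proof. by have [b Ub Eb] := mu_surj a; exists (exist _ b Ub). Qed.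

Lemma make_iso : exists2 h : coded_model make_wd -> A,
  is_isomorphism h & forall b : {b | U b}, h (cls _ _ b) = mu (sval b).
Proof.
have eE := wd_equiv make_wd.
have /choice[rep Hrep] (C : quot U (defE G B p)) : exists b, C = cls _ _ b.
  exact: quotP.
have hE (b : {b | U b}) : mu (sval (rep (cls U (defE G B p) b))) = mu (sval b).
  have /esym := Hrep (cls U (defE G B p) b).
  by rewrite cls_eq // muE //; apply: svalP.
exists (fun C => mu (sval (rep C))) => //; split.
- have /choice[g Hg] a : exists b : {b | U b}, mu (sval b) = a by exact: make_surj.
  exists (fun a => cls _ _ (g a)) => [C|a]; last by rewrite hE Hg.
  rewrite [RHS](Hrep C) cls_eq // muE //; try exact: svalP.
- move=> c; apply/muc; first exact: svalP.
  by apply/(coded_c_cls make_wd); apply: Hrep.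
- move=> f xs; pose C := finterp (coded_model make_wd) f xs.
  have := @muf f (sval (rep C)) (fun k => sval (rep (xs k))) (svalP _)
    (fun k => svalP _).
  case=> H _; apply/esym/H.
  apply/(coded_f_cls make_wd); rewrite -Hrep; congr finterp.
  by apply/funext => k; rewrite [LHS]/= -Hrep.
- move=> r xs.
  rewrite -[X in _ <-> X](@mur r (fun k => sval (rep (xs k))) (fun k => svalP _)).
  rewrite -(coded_r_cls make_wd); rewrite (_ : _ \o _ = xs) //.
  by apply/funext => k; rewrite [LHS]/= -Hrep.
Qed.

Definition make_interp : interpretation A B :=
  Interpretation make_surj make_iso.

Lemma make_interp_xcoord b : U b -> xcoord (i := make_interp) b = mu b.
Proof. by move=> Ub; rewrite (@xcoordE _ _ make_interp b Ub). Qed.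

End MakeInterpretation.

Lemma blocks_onblocks V W M d q (s : V -> W) (b : W -> tup M d) (p : tup M q) :
  blocks b p \o onblocks s = blocks (b \o s) p.
Proof. by apply/funext => -[[]|]. Qed.

Lemma blocks_unblock V M d q (b : V -> tup M d) (p : tup M q) (c : tup M d) :
  join (blocks b p) c \o @unblock V d q = blocks (push b c) p.
Proof. by apply/funext => -[[[]]|]. Qed.

Lemma sat_in_U L L' (G : code L L') (B : model L') p V (b : V -> tup B (dim G)) v :
  sat (blocks b p) (in_U G v) <-> defU G B p (b v).
Proof. by rewrite sat_rename blocks_onblocks. Qed.

Lemma sat_translate_body L L' (G : code L L') (B : model L') p (V : finType)
    (N : nform L V) (b : V -> tup B (dim G)) :
  sat (blocks b p) (translate G N) <->
  (forall v, defU G B p (b v)) /\ sat (blocks b p) (tr_body G N).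
Proof.
rewrite /translate sat_foldAnd; split=> -[Hb HN]; split=> // v.
  by have := Hb v (mem_enum _ v); rewrite sat_in_U.
by rewrite sat_in_U.
Qed.

Section TranslationLemma.
Variables (A B : structure) (i : interpretation A B).
Local Notation G := (icode i).
Local Notation p := (ipar i).
Local Notation U := (defU G B p).

Lemma sat_tr_unnested V (a : unnested _ V) (b : V -> tup B (dim G)) :
  (forall v, U (b v)) ->
  sat (blocks b p) (tr_unnested G a) <->
  sat (xcoord (i := i) \o b) (unnested_formula a).
Proof.
move=> Ub; case: a => [x x'|x c|f xs x0|r xs] /=; rewrite sat_rename blocks_onblocks.
- rewrite -(defE_xcoord (Ub x) (Ub x')) /defE.
  rewrite (_ : b \o _ = fun j : bool => if j then b x' else b x) //.
  by apply/funext => -[].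
- exact: defc_xcoord.
- rewrite -[X in _ <-> X](@deff_xcoord _ _ i f (b x0) (b \o xs)) //;
    last by move=> k; apply: Ub.
  rewrite /deff (_ : b \o _ = push (b \o xs) (b x0)) //.
  by apply/funext => -[].
- by apply: (@defr_xcoord _ _ i r (b \o xs)) => k; apply: Ub.
Qed.

Lemma push_U V (b : V -> tup B (dim G)) c : (forall v, U (b v)) -> U c ->
  forall v, U (push b c v).
Proof. by move=> Ub Uc []. Qed.

Lemma xcoord_push V (b : V -> tup B (dim G)) c :
  xcoord (i := i) \o push b c = push (xcoord (i := i) \o b) (xcoord (i := i) c).
Proof. by apply/funext => -[]. Qed.

Lemma sat_tr_body V (N : nform _ V) (b : V -> tup B (dim G)) :
  (forall v, U (b v)) ->
  sat (blocks b p) (tr_body G N) <-> sat (xcoord (i := i) \o b) (nf_formula N).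
Proof.
elim: N b => {}V.
- move=> D b Ub /=; rewrite !sat_dnf; apply: fold1_iff => C.
  apply: fold1_iff => -[s a]; rewrite !sat_signed /=.
  by case: s; rewrite sat_tr_unnested.
- move=> N IH b Ub /=; rewrite sat_blockEx; split=> [[c]|[a]].
    rewrite (sat_rename _ (And _ _)) blocks_unblock /= => -[/sat_in_U Uc].
    rewrite IH; last exact: push_U.
    by rewrite xcoord_push; exists (xcoord (i := i) c).
  have [c Uc <-] := xcoord_surj i a; rewrite -xcoord_push -IH; last exact: push_U.
  move=> H; exists c; rewrite (sat_rename _ (And _ _)) blocks_unblock /=; split=> //.
  exact/sat_in_U.
- move=> N IH b Ub /=; rewrite sat_blockAll; split=> [H a|H c].
    have [c Uc <-] := xcoord_surj i a; have := H c.
    rewrite (sat_rename _ (Imp _ _)) blocks_unblock /= => {}H.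
    rewrite -xcoord_push -IH; last exact: push_U.
    exact/H/sat_in_U.
  rewrite (sat_rename _ (Imp _ _)) blocks_unblock /= => /sat_in_U Uc.
  by rewrite IH; [rewrite xcoord_push|exact: push_U].
Qed.

Lemma sat_translate (V : finType) (N : nform _ V) (b : V -> tup B (dim G)) :
  sat (blocks b p) (translate G N) <->
  (forall v, U (b v)) /\ sat (xcoord (i := i) \o b) (nf_formula N).
Proof.
by rewrite sat_translate_body; split=> -[Ub H]; split=> //; apply/sat_tr_body.
Qed.

End TranslationLemma.

Definition comp_index (V : Type) (d1 q1 d2 q2 : nat)
    (x : (V * 'I_d1 + 'I_q1) * 'I_d2 + 'I_q2) :
    V * 'I_(d1 * d2) + 'I_(q1 * d2 + q2) :=
  match x with
  | inl (inl (v, i), j) => inl (v, flat_index (i, j))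
  | inl (inr k, j) => inr (lshift q2 (flat_index (k, j)))
  | inr l => inr (rshift (q1 * d2) l)
  end.

Section CodeComposition.
Variables (L L' L'' : language) (G : code L L') (D : code L' L'').

Definition comp_formula (V : finType) (phi : formula L' (bvars G V)) :
    formula L'' (V * 'I_(dim G * dim D) + 'I_(pdim G * dim D + pdim D)) :=
  rename (@comp_index V _ _ _ _) (translate D (nf phi)).

Definition code_comp : code L L'' := {|
  dim := dim G * dim D;
  pdim := pdim G * dim D + pdim D;
  codeU := comp_formula (codeU G);
  codeE := comp_formula (codeE G);
  codec := fun c => comp_formula (codec G c);
  codef := fun f => comp_formula (codef G f);
  coder := fun r => comp_formula (coder G r) |}.

End CodeComposition.

Lemma flat_indexK m d (x : 'I_m * 'I_d) :
  (flat_row (flat_index x), flat_col (flat_index x)) = x.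
Proof.
case: x => i j; have d_gt0 : 0 < d by apply: leq_trans (ltn_ord j).
congr pair; apply: val_inj => /=.
  by rewrite divnMDl // divn_small ?addn0.
by rewrite modnMDl modn_small.
Qed.

Lemma flat_rowK m d (k : 'I_(m * d)) : flat_index (flat_row k, flat_col k) = k.
Proof. by apply: val_inj; rewrite /= -divn_eq. Qed.

Lemma tflatK M m d (b : 'I_m -> tup M d) : tunflat (tflat b) = b.
Proof.
apply/funext => i; apply/funext => j; rewrite /tunflat /tflat.
by have [-> ->] := flat_indexK (i, j).
Qed.

Lemma tunflatK M m d (c : tup M (m * d)) : tflat (tunflat c) = c.
Proof. by apply/funext => k; rewrite /tunflat /tflat flat_rowK. Qed.

Lemma tconcat_lshift M m n (b : tup M m) (c : tup M n) k :
  tconcat b c (lshift n k) = b k.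
Proof. by rewrite /tconcat (unsplitK (inl k)). Qed.

Lemma tconcat_rshift M m n (b : tup M m) (c : tup M n) k :
  tconcat b c (rshift m k) = c k.
Proof. by rewrite /tconcat (unsplitK (inr k)). Qed.

Lemma blocks_comp_index V M d1 q1 d2 q2 (b : V -> tup M (d1 * d2))
    (p : 'I_q1 -> tup M d2) (q : tup M q2) :
  blocks b (tconcat (tflat p) q) \o @comp_index V d1 q1 d2 q2 =
  blocks (join (fun x => tunflat (b x.1) x.2) p) q.
Proof.
apply/funext => -[[[[v i]|k] j]|l] //=.
  by rewrite tconcat_lshift -[RHS](congr1 (fun f => f k j) (tflatK p)).
by rewrite tconcat_rshift.
Qed.

(* A choice of preimages of a tuple under the coordinate map. *)
Definition icoord_inv A B (i : interpretation A B) n (a : tup A n) :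
    'I_n -> tup B (dim (icode i)) :=
  fun k => sval (sval (cid (icoord_surj i (a k)))).

Arguments icoord_inv {A B} i {n} a k _.

Lemma icoord_invU A B (i : interpretation A B) n (a : tup A n) k :
  defU (icode i) B (ipar i) (icoord_inv i a k).
Proof. exact: svalP. Qed.

Lemma icoord_invK A B (i : interpretation A B) n (a : tup A n) :
  xcoord (i := i) \o icoord_inv i a = a.
Proof.
by apply/funext => k; rewrite /= xcoord_sval; exact: (svalP (cid (icoord_surj i (a k)))).
Qed.

Section Composition.
Variables (A B C : structure) (i : interpretation A B) (j : interpretation B C).

Definition comp_code := code_comp (icode i) (icode j).

Definition comp_par : tup C (pdim comp_code) :=
  tconcat (tflat (icoord_inv j (ipar i))) (ipar j).

Definition comp_xcoord (c : tup C (dim comp_code)) : A :=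
  xcoord (i := i) (fun k => xcoord (i := j) (tunflat c k)).

Lemma sat_comp_formula (V : finType) (phi : formula _ (bvars (icode i) V))
    (c : V -> tup C (dim comp_code)) :
  sat (blocks c comp_par) (comp_formula (icode j) phi) <->
  (forall v k, defU (icode j) C (ipar j) (tunflat (c v) k)) /\
  sat (blocks (fun v k => xcoord (i := j) (tunflat (c v) k)) (ipar i)) phi.
Proof.
rewrite sat_rename blocks_comp_index sat_translate.
rewrite -(nfP phi _); rewrite (_ : _ \o _ =
    blocks (fun v k => xcoord (i := j) (tunflat (c v) k)) (ipar i)); last first.
  apply/funext => -[//|k] /=.
  exact: (congr1 (fun f => f k) (icoord_invK j (ipar i))).
split=> -[HU H]; split=> //.
  by move=> v k; apply: (HU (inl (v, k))).
by move=> -[[v k]|k] /=; [apply: HU|apply: icoord_invU].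
Qed.

Lemma comp_defU c : defU comp_code C comp_par c <->
  (forall k, defU (icode j) C (ipar j) (tunflat c k)) /\
  defU (icode i) B (ipar i) (fun k => xcoord (i := j) (tunflat c k)).
Proof.
rewrite /defU /= (sat_comp_formula (codeU (icode i)) (fun _ => c)).
by split=> -[H ?]; split=> // k; apply: H tt k.
Qed.

Lemma comp_surj a : exists2 c, defU comp_code C comp_par c & comp_xcoord c = a.
Proof.
have [b Ub <-] := xcoord_surj i a.
have bE : (fun k => xcoord (i := j) (tunflat (tflat (icoord_inv j b)) k)) = b.
  by rewrite tflatK; exact: (icoord_invK j b).
exists (tflat (icoord_inv j b)); last by rewrite /comp_xcoord bE.
by rewrite comp_defU bE; split=> // k; rewrite tflatK; apply: icoord_invU.
Qed.

Lemma comp_E c c' : defU comp_code C comp_par c -> defU comp_code C comp_par c' ->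
  defE comp_code C comp_par c c' <-> comp_xcoord c = comp_xcoord c'.
Proof.
rewrite !comp_defU => -[Uc Ui] [Uc' Ui'].
rewrite /comp_xcoord -(defE_xcoord Ui Ui') /defE /=.
rewrite (sat_comp_formula (codeE (icode i)) (fun s : bool => if s then c' else c)).
have -> : (fun s : bool => if s then fun k => xcoord (i := j) (tunflat c' k)
    else fun k => xcoord (i := j) (tunflat c k)) =
    fun s k => xcoord (i := j) (tunflat (if s then c' else c) k).
  by apply/funext => -[].
by split=> [[_ H]//|H]; split=> // -[].
Qed.

Lemma comp_c s c : defU comp_code C comp_par c ->
  defc comp_code C comp_par s c <-> comp_xcoord c = cinterp A s.
Proof.
rewrite comp_defU => -[Uc Ui].
rewrite /comp_xcoord -(defc_xcoord s Ui) /defc /=.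
rewrite (sat_comp_formula (codec (icode i) s) (fun _ => c)).
by split=> [[_ H]//|H]; split.
Qed.

Lemma comp_f f c0 cs : defU comp_code C comp_par c0 ->
  (forall k, defU comp_code C comp_par (cs k)) ->
  deff comp_code C comp_par f c0 cs <->
  finterp A f (comp_xcoord \o cs) = comp_xcoord c0.
Proof.
rewrite comp_defU => -[Uc Ui] Us.
have Us1 k := (comp_defU _).1 (Us k).
rewrite -[X in _ <-> X](@deff_xcoord _ _ i f (fun k => xcoord (i := j) (tunflat c0 k))
   (fun l k => xcoord (i := j) (tunflat (cs l) k)) Ui (fun k => (Us1 k).2)).
rewrite /deff /= (sat_comp_formula (codef (icode i) f) (push cs c0)).
have -> : push (fun l k => xcoord (i := j) (tunflat (cs l) k))
    (fun k => xcoord (i := j) (tunflat c0 k)) =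
    fun v k => xcoord (i := j) (tunflat (push cs c0 v) k).
  by apply/funext => -[].
split=> [[_ H]//|H]; split=> // -[l|] k //=.
by have [] := Us1 l.
Qed.

Lemma comp_r r cs : (forall k, defU comp_code C comp_par (cs k)) ->
  defr comp_code C comp_par r cs <-> rinterp A r (comp_xcoord \o cs).
Proof.
move=> Us; have Us1 k := (comp_defU _).1 (Us k).
rewrite -[X in _ <-> X](@defr_xcoord _ _ i r
   (fun l k => xcoord (i := j) (tunflat (cs l) k)) (fun k => (Us1 k).2)).
rewrite /defr /= (sat_comp_formula (coder (icode i) r) cs).
by split=> [[_ H]//|H]; split=> // l k; have [] := Us1 l.
Qed.

(* The components of [comp_code] are translated via fixed normal forms, and the
   parameters of [i] are lifted to fixed preimages; other choices yield the same
   interpretation in the sense of [interp_eq]. *)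
Definition interp_comp : interpretation A C :=
  make_interp comp_surj comp_E comp_c comp_f comp_r.

End Composition.

Arguments comp_defU {A B C} i j c.
Arguments comp_par {A B C} i j _.

Definition id_code (L : language) : code L L := {|
  dim := 1;
  pdim := 0;
  codeU := Eq (Var (inl (tt, ord0))) (Var (inl (tt, ord0)));
  codeE := Eq (Var (inl (false, ord0))) (Var (inl (true, ord0)));
  codec := fun c => Eq (Var (inl (tt, ord0))) (Cst c);
  codef := fun f => Eq (App f (fun i => Var (inl (Some i, ord0))))
                       (Var (inl (None, ord0)));
  coder := fun r => Rel r (fun i => Var (inl (i, ord0))) |}.

Section Identity.
Variable A : structure.
Let p : tup A 0 := @ord0_elim A.
Let mu (b : tup A 1) : A := b ord0.

Lemma id_surj a : exists2 b, defU (id_code (lang A)) A p b & mu b = a.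
Proof. by exists (fun _ => a). Qed.

Lemma id_E b b' : defU (id_code (lang A)) A p b -> defU (id_code (lang A)) A p b' ->
  defE (id_code (lang A)) A p b b' <-> mu b = mu b'.
Proof. by []. Qed.

Lemma id_c c b : defU (id_code (lang A)) A p b ->
  defc (id_code (lang A)) A p c b <-> mu b = cinterp A c.
Proof. by []. Qed.

Lemma id_f f b0 bs : defU (id_code (lang A)) A p b0 ->
  (forall k, defU (id_code (lang A)) A p (bs k)) ->
  deff (id_code (lang A)) A p f b0 bs <-> finterp A f (mu \o bs) = mu b0.
Proof. by []. Qed.

Lemma id_r r bs : (forall k, defU (id_code (lang A)) A p (bs k)) ->
  defr (id_code (lang A)) A p r bs <-> rinterp A r (mu \o bs).
Proof. by []. Qed.

Definition interp_id : interpretation A A :=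
  make_interp id_surj id_E id_c id_f id_r.

End Identity.

(* By [interp_eqP], two interpretations are equal iff their coordinate maps have the same graph. *)
Definition graph A B (i : interpretation A B) : {d : nat & tup B d -> A -> Prop} :=
  existT _ (dim (icode i))
    (fun b a => defU (icode i) B (ipar i) b /\ xcoord (i := i) b = a).

Lemma graph_eq A B (d d' : nat) (g : tup B d -> A -> Prop) (g' : tup B d' -> A -> Prop) :
  existT (fun d => tup B d -> A -> Prop) d g = existT _ d' g' <->
  exists e : d = d', forall b a, g b a <-> g' (tcast e b) a.
Proof.
have cast1 (b : tup B d) : tcast erefl b = b.
  by apply/funext => k; rewrite /tcast cast_ord_id.
split=> [E|[e]].
  have e : d = d' := congr1 (@projT1 _ _) E.
  case: _ / e in g' E *; exists erefl => b a.
  have -> // : g = g' by apply: existT_inj2 E.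
  by rewrite cast1.
case: _ / e g' => g' H; congr existT; apply/funext => b; apply/funext => a.
by apply/propext; rewrite H cast1.
Qed.

Lemma tcast1 M d (e : d = d) (b : tup M d) : tcast e b = b.
Proof. by apply/funext => k; rewrite /tcast cast_ord_id. Qed.

Lemma interp_eqP A B (i j : interpretation A B) : interp_eq i j <-> graph i = graph j.
Proof.
rewrite graph_eq; split=> -[e H]; exists e.
  have [HU _ _ Hmu] := H => b a; split=> -[Ub <-].
    have Ub' := (HU b).1 Ub; split=> //.
    by rewrite (xcoordE Ub) (xcoordE Ub'); apply/esym/Hmu.
  have Ub' := (HU b).2 Ub; split=> //.
  by rewrite (xcoordE Ub) (xcoordE Ub'); apply/Hmu.
have HU b : defU (icode i) B (ipar i) b <-> defU (icode j) B (ipar j) (tcast e b).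
  by split=> Ub; [have [] := (H b _).1 (conj Ub erefl)
                 |have [] := (H b _).2 (conj Ub erefl)].
have Hx b : defU (icode i) B (ipar i) b ->
    xcoord (i := j) (tcast e b) = xcoord (i := i) b.
  by move=> Ub; have [] := (H b _).1 (conj Ub erefl).
split=> //.
- move=> b b' Ub Ub'; rewrite !defE_xcoord //; try exact/HU.
  by rewrite !Hx.
- split.
  + by move=> c b Ub; rewrite !defc_xcoord //; [rewrite Hx|apply/HU].
  + move=> f b0 bs U0 Us; rewrite !deff_xcoord //; first last.
    * by move=> k; apply/HU.
    * exact/HU.
    rewrite Hx // (_ : _ \o (_ \o _) = xcoord (i := i) \o bs) //.
    by apply/funext => k /=; rewrite Hx.
  + move=> r bs Us; rewrite !defr_xcoord //; last by move=> k; apply/HU.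
    rewrite (_ : _ \o (_ \o _) = xcoord (i := i) \o bs) //.
    by apply/funext => k /=; rewrite Hx.
- move=> [b Ub] [b' Ub'] /= E; rewrite -!xcoordE.
  by rewrite E Hx.
Qed.

Lemma interp_eq_equiv A B : equiv_on setT (@interp_eq A B).
Proof.
split=> [i _|i j _ _|i j k _ _ _]; rewrite !interp_eqP //.
by move=> -> ->.
Qed.

Definition graph_comp (A B C : Type) (g : {d : nat & tup B d -> A -> Prop})
    (h : {d : nat & tup C d -> B -> Prop}) : {d : nat & tup C d -> A -> Prop} :=
  existT _ (projT1 g * projT1 h) (fun c a => exists2 b,
    forall k, projT2 h (tunflat c k) (b k) & projT2 g b a).

Lemma graph_interp_comp A B C (i : interpretation A B) (j : interpretation B C) :
  graph (interp_comp i j) = graph_comp (graph i) (graph j).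
Proof.
congr existT; apply/funext => c; apply/funext => a; apply/propext.
split=> [[Uc]|[b Hb [Ub <-]]].
  rewrite make_interp_xcoord // => <-.
  have [Uj Ui] := (comp_defU i j c).1 Uc.
  by exists (fun k => xcoord (i := j) (tunflat c k)).
have bE : (fun k => xcoord (i := j) (tunflat c k)) = b.
  by apply/funext => k; have [] := Hb k.
have Uc : defU (comp_code i j) C (comp_par i j) c.
  by rewrite comp_defU bE; split=> // k; have [] := Hb k.
by split=> //; rewrite make_interp_xcoord // /comp_xcoord bE.
Qed.

Lemma graph_interp_id A : graph (interp_id A) =
  existT (fun d => tup A d -> A -> Prop) 1 (fun b a => b ord0 = a).
Proof.
congr existT; apply/funext => b; apply/funext => a; apply/propext.
have U : defU (icode (interp_id A)) A (ipar (interp_id A)) b by [].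
by rewrite make_interp_xcoord //; split=> [[]//|].
Qed.

Lemma graph_comp_assoc A B C D (g : {d & tup B d -> A -> Prop})
    (h : {d & tup C d -> B -> Prop}) (k : {d & tup D d -> C -> Prop}) :
  graph_comp (graph_comp g h) k = graph_comp g (graph_comp h k).
Proof.
case: g h k => [m g] [n h] [l k]; apply/graph_eq => /=.
exists (esym (mulnA m n l)) => d a.
have E (u : 'I_m) (v : 'I_n) : tunflat (tunflat (tcast (esym (mulnA m n l)) d) u) v =
    tunflat d (flat_index (u, v)).
  apply/funext => w; congr d; apply: val_inj => /=.
  by rewrite mulnDl mulnA addnA.
split=> [[c Hc [b Hb Hg]]|[b Hb Hg]].
  exists b => // u; exists (tunflat c u) => // v.
  by rewrite E; apply: Hc.
have /choice[c Hc] u : exists c : tup C n,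
    (forall v, k (tunflat d (flat_index (u, v))) (c v)) /\ h c (b u).
  by have [c Hc Hh] := Hb u; exists c; split=> // v; rewrite -E.
exists (tflat c).
  move=> x; rewrite -[in tunflat d x](flat_rowK x).
  by have [] := Hc (flat_row x).
by exists b => // u; rewrite tflatK; have [] := Hc u.
Qed.

Definition graph_id (A : Type) : {d & tup A d -> A -> Prop} :=
  existT (fun d => tup A d -> A -> Prop) 1 (fun b a => b ord0 = a).

Lemma graph_comp_id_l A B (g : {d & tup B d -> A -> Prop}) :
  graph_comp (graph_id A) g = g.
Proof.
case: g => [m g]; apply/graph_eq => /=; exists (mul1n m) => d a.
have E (u : 'I_1) : tunflat d u = tcast (mul1n m) d.
  by rewrite ord1; apply/funext => w; congr d; apply: val_inj.
split=> [[b Hb <-]|H]; first by rewrite -(E ord0).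
by exists (fun _ => a) => // u; rewrite E.
Qed.

Lemma graph_comp_id_r A B (g : {d & tup B d -> A -> Prop}) :
  graph_comp g (graph_id B) = g.
Proof.
case: g => [m g]; apply/graph_eq => /=; exists (muln1 m) => d a.
have E (u : 'I_m) : tunflat d u ord0 = tcast (muln1 m) d u.
  by congr d; apply: val_inj; rewrite /= muln1 addn0.
split=> [[b Hb]|H]; last by exists (tcast (muln1 m) d) => // u; rewrite E.
by rewrite (_ : b = tcast (muln1 m) d) //; apply/funext => u; rewrite -E Hb.
Qed.

Record category := Category {
  obj : Type;
  hom : obj -> obj -> Type;
  idc : forall x, hom x x;
  compc : forall x y z, hom y z -> hom x y -> hom x z;
  compc1 : forall x y (f : hom x y), compc f (idc x) = f;
  comp1c : forall x y (f : hom x y), compc (idc y) f = f;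
  compcA : forall x y z t (h : hom z t) (g : hom y z) (f : hom x y),
    compc h (compc g f) = compc (compc h g) f }.

Arguments idc {_} _.
Arguments compc {_ _ _ _} _ _.

Record functor (C D : category) := Functor {
  fobj : obj C -> obj D;
  fmap : forall x y, hom x y -> hom (fobj x) (fobj y);
  fmap1 : forall x, fmap (idc x) = idc (fobj x);
  fmapM : forall x y z (g : hom y z) (f : hom x y),
    fmap (compc g f) = compc (fmap g) (fmap f) }.

Arguments fobj {C D} _ _.
Arguments fmap {C D} _ {x y} _.

Definition functor_id (C : category) : functor C C :=
  @Functor C C id (fun _ _ => id) (fun=> erefl) (fun _ _ _ _ _ => erefl).

Lemma functor_comp1 C D E (G : functor D E) (F : functor C D) x :
  fmap G (fmap F (idc x)) = idc (fobj G (fobj F x)).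
Proof. by rewrite !fmap1. Qed.

Lemma functor_compM C D E (G : functor D E) (F : functor C D) x y z
    (g : hom y z) (f : hom x y) :
  fmap G (fmap F (compc g f)) = compc (fmap G (fmap F g)) (fmap G (fmap F f)).
Proof. by rewrite !fmapM. Qed.

Definition functor_comp (C D E : category) (G : functor D E) (F : functor C D) :
    functor C E :=
  @Functor C E (fobj G \o fobj F) (fun x y f => fmap G (fmap F f))
    (functor_comp1 G F) (functor_compM G F).

Definition isomorphic (C D : category) : Prop :=
  exists (F : functor C D) (G : functor D C),
    functor_comp G F = functor_id C /\ functor_comp F G = functor_id D.

(* Interpretations up to equality *)
Definition AS_hom (A B : structure) : Type := quot setT (@interp_eq A B).

Definition interp_class A B (i : interpretation A B) : AS_hom A B :=
  cls setT _ (exist _ i I).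

Lemma interp_classP A B (f : AS_hom A B) : exists i, interp_class i = f.
Proof. by have [[i []] ->] := quotP f; exists i. Qed.

Definition interp_repr A B (f : AS_hom A B) : interpretation A B :=
  sval (cid (interp_classP f)).

Lemma interp_reprK A B (f : AS_hom A B) : interp_class (interp_repr f) = f.
Proof. exact: svalP (cid (interp_classP f)). Qed.

Lemma interp_class_eq A B (i j : interpretation A B) :
  interp_class i = interp_class j <-> interp_eq i j.
Proof. exact: cls_eq (@interp_eq_equiv A B). Qed.

Definition AS_comp A B C (g : AS_hom B C) (f : AS_hom A B) : AS_hom A C :=
  interp_class (interp_comp (interp_repr f) (interp_repr g)).

Lemma interp_comp_eq A B C (i i' : interpretation A B) (j j' : interpretation B C) :
  interp_eq i i' -> interp_eq j j' ->
  interp_eq (interp_comp i j) (interp_comp i' j').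
Proof. by rewrite !interp_eqP !graph_interp_comp => -> ->. Qed.

Lemma AS_compE A B C (i : interpretation A B) (j : interpretation B C) :
  AS_comp (interp_class j) (interp_class i) = interp_class (interp_comp i j).
Proof.
by apply/interp_class_eq/interp_comp_eq; apply/interp_class_eq; rewrite interp_reprK.
Qed.

Lemma AS_comp1 A B (f : AS_hom A B) : AS_comp f (interp_class (interp_id A)) = f.
Proof.
have [i <-] := interp_classP f; rewrite AS_compE.
apply/interp_class_eq/interp_eqP.
by rewrite graph_interp_comp graph_interp_id graph_comp_id_l.
Qed.

Lemma AS_1comp A B (f : AS_hom A B) : AS_comp (interp_class (interp_id B)) f = f.
Proof.
have [i <-] := interp_classP f; rewrite AS_compE.
apply/interp_class_eq/interp_eqP.
by rewrite graph_interp_comp graph_interp_id graph_comp_id_r.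
Qed.

Lemma AS_compA A B C D (h : AS_hom C D) (g : AS_hom B C) (f : AS_hom A B) :
  AS_comp h (AS_comp g f) = AS_comp (AS_comp h g) f.
Proof.
have [i <-] := interp_classP f; have [j <-] := interp_classP g.
have [k <-] := interp_classP h; rewrite !AS_compE.
apply/interp_class_eq/interp_eqP.
by rewrite !graph_interp_comp graph_comp_assoc.
Qed.

Definition AS : category := {|
  obj := structure;
  hom := AS_hom;
  idc := fun A => interp_class (interp_id A);
  compc := AS_comp;
  compc1 := AS_comp1;
  comp1c := AS_1comp;
  compcA := AS_compA |}.

(* A formula of the language of [A] expanded by the elements of [A], given by a
   formula psi(x, z_1, ..., z_s) of the language of [A] and by the s elements of [A]
   that are substituted for the z_i. *)
Record pformula (A : structure) (V : Type) := PFormula {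
  npar : nat;
  pform : formula (lang A) (V + 'I_npar);
  pval : tup A npar }.

Arguments pval {A V} _ _.

Definition psat (A : structure) (V : Type) (psi : pformula A V) (e : V -> A) : Prop :=
  sat (join e (pval psi)) (pform psi).

Definition Vset (A : structure) (m : nat) (S : set (pformula A 'I_m)) : set (tup A m) :=
  [set a | forall psi, S psi -> psat psi a].

Section ProjectiveLogicalSets.
Variable A : structure.

(* The relation induced by [E] on [X], as a subset of [X * X], so that equal
   relations on [X] are Leibniz equal. *)
Definition induced (m : nat) (X : set (tup A m)) (E : pformula A ('I_m + 'I_m))
    (a b : tup A m) : Prop :=
  [/\ X a, X b & psat E (join a b)].

Definition induces_equiv (m : nat) (X : set (tup A m)) (E : pformula A ('I_m + 'I_m)) :
    Prop :=
  equiv_on X (induced X E) /\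
  forall a a', X a -> psat E (join a a') \/ psat E (join a' a) -> X a'.

Record pls := Pls {
  pls_arity : nat;
  pls_set : set (tup A pls_arity);
  pls_rel : tup A pls_arity -> tup A pls_arity -> Prop;
  pls_nonempty : pls_set !=set0;
  pls_logical : exists S, pls_set = Vset S;
  pls_equiv : exists2 E, induces_equiv pls_set E & pls_rel = induced pls_set E }.

Definition pls_quot (X : pls) : Type := quot (@pls_set X) (@pls_rel X).

Definition induces_map (m s : nat) (X : set (tup A m)) (R : tup A m -> tup A m -> Prop)
    (Y : set (tup A s)) (Q : tup A s -> tup A s -> Prop)
    (phi : pformula A ('I_m + 'I_s)) (F : quot X R -> quot Y Q) : Prop :=
  (forall (a : {a | X a}) (b : {b | Y b}),
     F (cls X R a) = cls Y Q b <-> psat phi (join (sval a) (sval b))) /\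
  (forall a b, X a -> ~ Y b -> ~ psat phi (join a b)).

Definition formula_map (X Y : pls) : Type :=
  {F : pls_quot X -> pls_quot Y | exists phi, induces_map phi F}.

(* The formula [exists y, phi(x, y) /\ psi(y, z)] *)
Definition pcomp_left (m s r p q : nat) (x : ('I_m + 'I_s) + 'I_p) :
    ('I_m + 'I_r) + 'I_(p + q) + 'I_s :=
  match x with
  | inl (inl i) => inl (inl (inl i))
  | inl (inr j) => inr j
  | inr k => inl (inr (lshift q k))
  end.

Definition pcomp_right (m s r p q : nat) (x : ('I_s + 'I_r) + 'I_q) :
    ('I_m + 'I_r) + 'I_(p + q) + 'I_s :=
  match x with
  | inl (inl j) => inr j
  | inl (inr i) => inl (inl (inr i))
  | inr k => inl (inr (rshift p k))
  end.

Definition pcomp (m s r : nat) (phi : pformula A ('I_m + 'I_s))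
    (psi : pformula A ('I_s + 'I_r)) : pformula A ('I_m + 'I_r) :=
  @PFormula A _ (npar phi + npar psi)
    (blockq (@Ex (lang A))
      (And (rename (@pcomp_left m s r _ _) (pform phi))
           (rename (@pcomp_right m s r _ _) (pform psi))))
    (tconcat (pval phi) (pval psi)).

Lemma psat_pcomp m s r (phi : pformula A ('I_m + 'I_s))
    (psi : pformula A ('I_s + 'I_r)) (a : tup A m) (c : tup A r) :
  psat (pcomp phi psi) (join a c) <->
  exists b : tup A s, psat phi (join a b) /\ psat psi (join b c).
Proof.
have El b : join (join (join a c) (tconcat (pval phi) (pval psi))) b \o
    @pcomp_left m s r _ _ = join (join a b) (pval phi).
  by apply/funext => -[[]|k] //=; rewrite tconcat_lshift.
have Er b : join (join (join a c) (tconcat (pval phi) (pval psi))) b \o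
    @pcomp_right m s r _ _ = join (join b c) (pval psi).
  by apply/funext => -[[]|k] //=; rewrite tconcat_rshift.
rewrite /psat sat_blockEx /=.
by split=> -[b [H1 H2]]; exists b; move: H1 H2; rewrite !sat_rename El Er.
Qed.

Lemma pls_rel_equiv (X : pls) : equiv_on (@pls_set X) (@pls_rel X).
Proof. by have [E [eE _] ->] := pls_equiv X. Qed.

Section InducedMaps.
Variables (m s r : nat).
Variables (X : set (tup A m)) (R : tup A m -> tup A m -> Prop).
Variables (Y : set (tup A s)) (Q : tup A s -> tup A s -> Prop).
Variables (Z : set (tup A r)) (T : tup A r -> tup A r -> Prop).

Lemma induces_map_inj phi (F G : quot X R -> quot Y Q) :
  induces_map phi F -> induces_map phi G -> F = G.
Proof.
move=> [HF _] [HG _]; apply/funext => C; have [a ->] := quotP C.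
have [b Hb] := quotP (F (cls X R a)); rewrite Hb; apply/esym.
by apply/HG/HF.
Qed.

Lemma induces_map_comp phi psi (F : quot X R -> quot Y Q) (G : quot Y Q -> quot Z T) :
  induces_map phi F -> induces_map psi G -> induces_map (pcomp phi psi) (G \o F).
Proof.
move=> [HF F2] [HG G2]; split=> [a c|a c Xa Zc]; rewrite psat_pcomp.
  have [b Hb] := quotP (F (cls X R a)).
  split=> [H|[b' [Hphi Hpsi]]].
    by exists (sval b); split; [apply/HF|apply/HG; rewrite -Hb].
  have [Yb'|] := pselect (Y b'); last by move=> /F2 /(_ Hphi); case; apply: svalP.
  rewrite /= ((HF a (exist _ b' Yb')).2 Hphi).
  by apply/HG.
move=> [b' [Hphi Hpsi]].
have [Yb'|] := pselect (Y b'); last by move=> /F2 /(_ Hphi); case.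
by apply: G2 Hpsi.
Qed.

End InducedMaps.

Lemma induces_map_id m (X : set (tup A m)) E : induces_equiv X E ->
  induces_map E (@id (quot X (induced X E))).
Proof.
move=> [eE E2]; split=> [a b|a b Xa Yb HE].
  rewrite (cls_eq _ _ eE) /induced; split=> [[]//|H].
  by split=> //; apply: svalP.
by apply/Yb/(E2 a) => //; left.
Qed.

Lemma formula_map_eq (X Y : pls) (f g : formula_map X Y) : sval f = sval g -> f = g.
Proof. by case: f g => [f Hf] [g Hg] /= fg; apply: eq_exist. Qed.

Lemma formula_map_id_subproof (X : pls) : exists phi, induces_map phi (@id (pls_quot X)).
Proof.
have [E eE EE] := pls_equiv X; exists E; rewrite /pls_quot EE.
exact: induces_map_id.
Qed.

Definition formula_map_id (X : pls) : formula_map X X :=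
  exist _ id (formula_map_id_subproof X).

Lemma formula_map_comp_subproof (X Y Z : pls) (g : formula_map Y Z) (f : formula_map X Y) :
  exists phi, induces_map phi (sval g \o sval f).
Proof.
have [psi Hpsi] := svalP g; have [phi Hphi] := svalP f.
by exists (pcomp phi psi); apply: induces_map_comp.
Qed.

Definition formula_map_comp (X Y Z : pls) (g : formula_map Y Z) (f : formula_map X Y) :
    formula_map X Z :=
  exist _ (sval g \o sval f) (formula_map_comp_subproof g f).

(* [None] is the empty set *)
Definition pls_hom (X Y : option pls) : Type :=
  match X, Y with
  | None, _ => unit
  | Some _, None => Empty_set
  | Some X, Some Y => formula_map X Y
  end.

Definition pls_id (X : option pls) : pls_hom X X :=
  match X with None => tt | Some X => formula_map_id X end.

Definition pls_comp (X Y Z : option pls) : pls_hom Y Z -> pls_hom X Y -> pls_hom X Z :=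
  match X, Y, Z with
  | None, _, _ => fun _ _ => tt
  | Some _, None, _ => fun _ f => match f with end
  | Some _, Some _, None => fun g _ => match g with end
  | Some _, Some _, Some _ => fun g f => formula_map_comp g f
  end.

Lemma pls_comp1 X Y (f : pls_hom X Y) : pls_comp f (pls_id X) = f.
Proof. by case: X Y f => [X|] [Y|] //= [] // f Hf; apply: eq_exist. Qed.

Lemma pls_1comp X Y (f : pls_hom X Y) : pls_comp (pls_id Y) f = f.
Proof. by case: X Y f => [X|] [Y|] //= [] // f Hf; apply: eq_exist. Qed.

Lemma pls_compA X Y Z W (h : pls_hom Z W) (g : pls_hom Y Z) (f : pls_hom X Y) :
  pls_comp h (pls_comp g f) = pls_comp (pls_comp h g) f.
Proof.
case: X Y Z W f g h => [X|] [Y|] [Z|] [W|] //= f g h;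
  by [apply: eq_exist|case: f|case: g|case: h].
Qed.

Definition PLS : category := {|
  obj := option pls;
  hom := pls_hom;
  idc := pls_id;
  compc := pls_comp;
  compc1 := pls_comp1;
  comp1c := pls_1comp;
  compcA := pls_compA |}.

End ProjectiveLogicalSets.

Record extcode (A B : structure) := ExtCode {
  ecode : code (lang A) (lang B);
  epar : tup B (pdim ecode);
  egamma : A -> tup B (dim ecode) }.

Arguments epar {A B} _ _.
Arguments egamma {A B} _ _ _.

(* The variables of the translation of a formula psi(x, z): the block of x is
   mapped by [s] to the variables of the result, the blocks of z and the parameters
   of the code are the places of the elements of [B]. *)
Definition par_index (V W : Type) (d q n : nat) (s : V * 'I_d -> W)
    (x : (V + 'I_n) * 'I_d + 'I_q) : W + 'I_(n * d + q) :=
  match x with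
  | inl (inl v, i) => inl (s (v, i))
  | inl (inr k, i) => inr (lshift q (flat_index (k, i)))
  | inr l => inr (rshift (n * d) l)
  end.

Definition flat_index2 (m s d : nat) (x : ('I_m + 'I_s) * 'I_d) :
    'I_(m * d) + 'I_(s * d) :=
  match x with
  | (inl i, j) => inl (flat_index (i, j))
  | (inr i, j) => inr (flat_index (i, j))
  end.

Section Translations.
Variables (A B : structure) (T : extcode A B).
Local Notation d := (dim (ecode T)).

Definition ptranslate (V : finType) (W : Type) (s : V * 'I_d -> W) (n : nat)
    (N : nform (lang A) (V + 'I_n)) (a : tup A n) : pformula B W :=
  @PFormula B W (n * d + pdim (ecode T))
    (rename (par_index s) (translate (ecode T) N))
    (tconcat (tflat (egamma T \o a)) (epar T)).

(* [psi'] is the translation of [psi] by means of some normal form of [psi]. *)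
Definition is_translation (V : finType) (W : Type) (s : V * 'I_d -> W)
    (psi : pformula A V) (psi' : pformula B W) : Prop :=
  exists2 N, is_nf_of N (pform psi) & psi' = ptranslate s N (pval psi).

Definition is_translation1 (m : nat) (psi : pformula A 'I_m)
    (psi' : pformula B 'I_(m * d)) : Prop :=
  is_translation (@flat_index m d) psi psi'.

Definition is_translation2 (m s : nat) (psi : pformula A ('I_m + 'I_s))
    (psi' : pformula B ('I_(m * d) + 'I_(s * d))) : Prop :=
  is_translation (@flat_index2 m s d) psi psi'.

(* [S'] is obtained from [S] by translating its elements by means of some choice of
   normal forms. *)
Definition is_system_translation (m : nat) (S : set (pformula A 'I_m))
    (S' : set (pformula B 'I_(m * d))) : Prop :=
  exists2 tr : pformula A 'I_m -> pformula B 'I_(m * d),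
    forall psi, S psi -> is_translation1 psi (tr psi) & S' = tr @` S.

(* A non-empty projective logical set over [A], given by a system and a formula,
   together with translations of these. *)
Record presentation (m : nat) := Presentation {
  prS : set (pformula A 'I_m);
  prS' : set (pformula B 'I_(m * d));
  prE : pformula A ('I_m + 'I_m);
  prE' : pformula B ('I_(m * d) + 'I_(m * d));
  pr_system : prS !=set0;
  pr_nonempty : Vset prS !=set0;
  pr_equiv : induces_equiv (Vset prS) prE;
  pr_transS : is_system_translation prS prS';
  pr_transE : is_translation2 prE prE' }.

Definition pr_quot m (X : presentation m) : Type :=
  quot (Vset (prS X)) (induced (Vset (prS X)) (prE X)).

Definition pr_quot' m (X : presentation m) : Type :=
  quot (Vset (prS' X)) (induced (Vset (prS' X)) (prE' X)).

Definition same_equiv (C : structure) (m : nat) (X : set (tup C m))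
    (E E' : pformula C ('I_m + 'I_m)) : Prop :=
  [/\ induces_equiv X E, induces_equiv X E' &
      forall a b, X a -> X b -> (psat E (join a b) <-> psat E' (join a b))].

(* In [fc3]-[fc7], an object X/~ and its translation are given by a [presentation],
   and every primed formula is an arbitrary translation of the unprimed one. *)
Record functor_conditions : Prop := FunctorConditions {
  fc1 : forall m (S : set (pformula A 'I_m)) S', S !=set0 ->
    is_system_translation S S' -> (Vset S = set0 <-> Vset S' = set0);
  fc2 : forall m (S1 S2 : set (pformula A 'I_m)) S1' S2', S1 !=set0 -> S2 !=set0 ->
    is_system_translation S1 S1' -> is_system_translation S2 S2' ->
    Vset S1 = Vset S2 -> Vset S1' = Vset S2';
  fc3 : forall m (X : presentation m), induces_equiv (Vset (prS' X)) (prE' X);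
  fc4 : forall m (X : presentation m) E E', is_translation2 E E' ->
    same_equiv (Vset (prS X)) (prE X) E ->
    same_equiv (Vset (prS' X)) (prE' X) E';
  fc5 : forall m s (X : presentation m) (Y : presentation s) phi phi',
    is_translation2 phi phi' ->
    (exists F : pr_quot X -> pr_quot Y, induces_map phi F) ->
    exists F' : pr_quot' X -> pr_quot' Y, induces_map phi' F';
  fc6 : forall m s (X : presentation m) (Y : presentation s) phi phi' psi psi',
    is_translation2 phi phi' -> is_translation2 psi psi' ->
    (exists F : pr_quot X -> pr_quot Y, induces_map phi F /\ induces_map psi F) ->
    exists F' : pr_quot' X -> pr_quot' Y, induces_map phi' F' /\ induces_map psi' F';
  fc7 : forall m s r (X : presentation m) (Y : presentation s) (Z : presentation r)
      phi phi' psi psi' chi',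
    is_translation2 phi phi' -> is_translation2 psi psi' ->
    is_translation2 (pcomp phi psi) chi' ->
    (exists F : pr_quot X -> pr_quot Y, induces_map phi F) ->
    (exists G : pr_quot Y -> pr_quot Z, induces_map psi G) ->
    forall (F' : pr_quot' X -> pr_quot' Y) (G' : pr_quot' Y -> pr_quot' Z),
      induces_map phi' F' -> induces_map psi' G' -> induces_map chi' (G' \o F') }.

Lemma translation_ex (V : finType) W (s : V * 'I_d -> W) (psi : pformula A V) :
  exists psi', is_translation s psi psi'.
Proof.
by exists (ptranslate s (nf (pform psi)) (pval psi)), (nf (pform psi)); [apply: nfP|].
Qed.

Lemma system_translation_ex m (S : set (pformula A 'I_m)) :
  exists S', is_system_translation S S'.
Proof.
pose tr (psi : pformula A 'I_m) := ptranslate (@flat_index m d) (nf (pform psi)) (pval psi).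
exists (tr @` S), tr => // psi _.
by exists (nf (pform psi)); [apply: nfP|].
Qed.

(* A formula without free variables that holds everywhere *)
Definition ptrue V : pformula A V :=
  @PFormula A V 0 (Ex (Eq (Var None) (Var None))) (@ord0_elim A).

Lemma psat_true V (e : V -> A) : psat (ptrue V) e.
Proof. by have [a _] := model_nonempty A; exists a. Qed.

Lemma pls_presentation (X : pls A) : exists Y : presentation (pls_arity X),
  Vset (prS Y) = @pls_set _ X /\
  induced (Vset (prS Y)) (prE Y) = @pls_rel _ X.
Proof.
case: X => m X R ne [S XS] [E eE RE] /=.
pose S1 := S `|` [set ptrue 'I_m].
have XS1 : Vset S1 = X.
  rewrite XS; apply/seteqP; split=> a Ha psi; first by move=> Spsi; apply: Ha; left.
  by case=> [/Ha//|->]; apply: psat_true.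
have [S' HS'] := system_translation_ex S1.
have [E' HE'] := translation_ex (@flat_index2 m m d) E.
rewrite -XS1 in ne eE RE *.
have neS : S1 !=set0 by exists (ptrue 'I_m); right.
by exists (Presentation neS ne eE HS' HE'); rewrite RE.
Qed.

Hypothesis fc : functor_conditions.

Definition pls_pres (X : pls A) : presentation (pls_arity X) :=
  sval (cid (pls_presentation X)).

Lemma pls_pres_set X : Vset (prS (pls_pres X)) = @pls_set _ X.
Proof. by case: (svalP (cid (pls_presentation X))). Qed.

Lemma pls_pres_rel X : induced (Vset (prS (pls_pres X))) (prE (pls_pres X)) = @pls_rel _ X.
Proof. by case: (svalP (cid (pls_presentation X))). Qed.

Lemma pr_nonempty' m (X : presentation m) : Vset (prS' X) !=set0.
Proof.
apply/set0P/eqP => H.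
have /set0P/eqP := pr_nonempty X; apply.
exact/(fc1 fc (pr_system X) (pr_transS X)).
Qed.

(* The image of an object; by [fc2] and [fc4] it does not depend on the choice of the
   system, of the formula and of their translations, see [tr_objP]. *)
Definition tr_obj (X : pls A) : pls B :=
  @Pls B (pls_arity X * d) (Vset (prS' (pls_pres X)))
    (induced (Vset (prS' (pls_pres X))) (prE' (pls_pres X)))
    (pr_nonempty' (pls_pres X))
    (ex_intro _ (prS' (pls_pres X)) erefl)
    (ex_intro2 _ _ (prE' (pls_pres X)) (fc3 fc (pls_pres X)) erefl).

Lemma tr_objP (X : pls A) (Y : presentation (pls_arity X)) :
  Vset (prS Y) = @pls_set _ X -> induced (Vset (prS Y)) (prE Y) = @pls_rel _ X ->
  @pls_set _ (tr_obj X) = Vset (prS' Y) /\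
  @pls_rel _ (tr_obj X) = induced (Vset (prS' Y)) (prE' Y).
Proof.
move=> YX YR; rewrite /=.
have EV : Vset (prS (pls_pres X)) = Vset (prS Y) by rewrite pls_pres_set.
have EV' := fc2 fc (pr_system _) (pr_system Y) (pr_transS _) (pr_transS Y) EV.
have [_ _ H] : same_equiv (Vset (prS' (pls_pres X))) (prE' (pls_pres X)) (prE' Y).
  apply: (fc4 fc (pr_transE Y)); split; first exact: pr_equiv.
    by rewrite EV; apply: pr_equiv.
  move=> a b Xa Xb; have H : induced (Vset (prS (pls_pres X))) (prE (pls_pres X)) a b
      <-> induced (Vset (prS Y)) (prE Y) a b by rewrite pls_pres_rel YR.
  by case: H => H1 H2; split=> E; [case: H1|case: H2]; rewrite -?EV.
split=> //; apply/funext => a; apply/funext => b; apply/propext; rewrite -EV'.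
by split=> -[Xa Xb E]; split=> //; apply/(H _ _ Xa Xb).
Qed.

Lemma quot_transport (C : structure) m s (X X1 : set (tup C m)) R R1 (Y Y1 : set (tup C s)) Q Q1
    (P : forall X R Y Q, (quot X R -> quot Y Q) -> Prop) :
  X = X1 -> R = R1 -> Y = Y1 -> Q = Q1 ->
  (exists F : quot X R -> quot Y Q, P X R Y Q F) ->
  exists F : quot X1 R1 -> quot Y1 Q1, P X1 R1 Y1 Q1 F.
Proof. by move=> <- <- <- <-. Qed.

Lemma pres_map (X Y : pls A) (phi : pformula A ('I_(pls_arity X) + 'I_(pls_arity Y)))
    (f : pls_quot X -> pls_quot Y) : induces_map phi f ->
  exists F : pr_quot (pls_pres X) -> pr_quot (pls_pres Y), induces_map phi F.
Proof.
move=> H; apply: (quot_transport (P := fun X R Y Q F => induces_map phi F)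
  (esym (pls_pres_set X)) (esym (pls_pres_rel X))
  (esym (pls_pres_set Y)) (esym (pls_pres_rel Y))).
by exists f.
Qed.

Lemma tr_map_ex (X Y : pls A) (f : formula_map X Y) :
  exists g : formula_map (tr_obj X) (tr_obj Y), exists phi phi',
    [/\ induces_map phi (sval f), is_translation2 phi phi' & induces_map phi' (sval g)].
Proof.
have [phi Hphi] := svalP f.
have [phi' Hphi'] := translation_ex (@flat_index2 _ _ d) phi.
have [g Hg] := fc5 fc Hphi' (pres_map Hphi).
by exists (exist _ g (ex_intro _ phi' Hg)); exists phi, phi'.
Qed.

(* The image of a morphism; by [fc6] it does not depend on the choice of the formula
   and of its translation, see [tr_mapP]. *)
Definition tr_map (X Y : pls A) (f : formula_map X Y) : formula_map (tr_obj X) (tr_obj Y) :=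
  sval (cid (tr_map_ex f)).

Lemma tr_mapP (X Y : pls A) (f : formula_map X Y) phi phi' :
  induces_map phi (sval f) -> is_translation2 phi phi' ->
  induces_map phi' (sval (tr_map f)).
Proof.
move=> Hf Hphi; have [psi [psi' [Hpsi Ht Hg]]] := svalP (cid (tr_map_ex f)).
have [] := fc6 fc Hphi Ht (X := pls_pres X) (Y := pls_pres Y).
  apply: (quot_transport (P := fun X R Y Q F => induces_map phi F /\ induces_map psi F)
    (esym (pls_pres_set X)) (esym (pls_pres_rel X))
    (esym (pls_pres_set Y)) (esym (pls_pres_rel Y))).
  by exists (sval f).
move=> F' [H1 H2].
by rewrite -[sval (tr_map f)](induces_map_inj H2 Hg).
Qed.

Definition functor_obj (X : option (pls A)) : option (pls B) := omap tr_obj X.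

Definition functor_map (X Y : option (pls A)) :
    pls_hom X Y -> pls_hom (functor_obj X) (functor_obj Y) :=
  match X, Y return pls_hom X Y -> pls_hom (functor_obj X) (functor_obj Y) with
  | None, _ => fun _ => tt
  | Some _, None => fun f => f
  | Some _, Some _ => fun f => tr_map f
  end.

Lemma functor_map1 (X : option (pls A)) : functor_map (pls_id X) = pls_id (functor_obj X).
Proof.
case: X => [X|] //=; apply: formula_map_eq.
have H : induces_map (prE (pls_pres X)) (sval (formula_map_id X)).
  rewrite /= /pls_quot -pls_pres_set -pls_pres_rel.
  exact/induces_map_id/pr_equiv.
have H1 := tr_mapP H (pr_transE (pls_pres X)).
rewrite [LHS](induces_map_inj H1 (induces_map_id (fc3 fc (pls_pres X)))) //.
Qed.

Lemma functor_mapM (X Y Z : option (pls A)) (g : pls_hom Y Z) (f : pls_hom X Y) :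
  functor_map (pls_comp g f) = pls_comp (functor_map g) (functor_map f).
Proof.
case: X Y Z f g => [X|] [Y|] [Z|] //= f g; try by [case: f|case: g].
apply: formula_map_eq.
have [phi Hphi] := svalP f; have [psi Hpsi] := svalP g.
have [phi' Hphi'] := translation_ex (@flat_index2 _ _ d) phi.
have [psi' Hpsi'] := translation_ex (@flat_index2 _ _ d) psi.
have [chi' Hchi'] := translation_ex (@flat_index2 _ _ d) (pcomp phi psi).
have Hgf : induces_map (pcomp phi psi) (sval (formula_map_comp g f)).
  exact: induces_map_comp.
apply: (induces_map_inj (tr_mapP Hgf Hchi')).
apply: (fc7 fc Hphi' Hpsi' Hchi' (pres_map Hphi) (pres_map Hpsi)
  (X := pls_pres X) (Y := pls_pres Y) (Z := pls_pres Z)).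
  exact: (tr_mapP Hphi Hphi').
exact: (tr_mapP Hpsi Hpsi').
Qed.

Definition interpretation_functor : functor (PLS A) (PLS B) :=
  @Functor (PLS A) (PLS B) functor_obj functor_map functor_map1 functor_mapM.

End Translations.

Definition is_interpretation_functor A B (F : functor (PLS A) (PLS B)) : Prop :=
  exists (T : extcode A B) (fc : functor_conditions T), F = interpretation_functor fc.

Section FormulaMaps.
Variables (A : structure) (m s : nat).
Variables (X : set (tup A m)) (R : tup A m -> tup A m -> Prop).
Variables (Y : set (tup A s)) (Q : tup A s -> tup A s -> Prop).
Hypotheses (eR : equiv_on X R) (eQ : equiv_on Y Q).

Definition defines_map (phi : pformula A ('I_m + 'I_s)) : Prop :=
  [/\ forall a, X a -> exists2 b, Y b & psat phi (join a b),
      forall a a' b b', X a -> X a' -> Y b -> Y b' -> R a a' ->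
        psat phi (join a b) -> (psat phi (join a' b') <-> Q b b')
    & forall a b, X a -> ~ Y b -> ~ psat phi (join a b)].

Lemma induces_map_ex phi :
  (exists F : quot X R -> quot Y Q, induces_map phi F) <-> defines_map phi.
Proof.
split=> [[F [F1 F2]]|[H1 H2 H3]].
  split=> // [a Xa|a a' b b' Xa Xa' Yb Yb' Raa' Hab].
    have [b Hb] := quotP (F (cls X R (exist _ a Xa))).
    exists (sval b); first exact: svalP.
    exact/(F1 (exist _ a Xa) b).
  rewrite -(F1 (exist _ a' Xa') (exist _ b' Yb')).
  have -> : cls X R (exist _ a' Xa') = cls X R (exist _ a Xa).
    by rewrite cls_eq //=; case: eR => _ + _; apply.
  have -> : F (cls X R (exist _ a Xa)) = cls Y Q (exist _ b Yb) by exact/F1.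
  by rewrite cls_eq.
have /choice[F HF] (C : quot X R) : exists D : quot Y Q,
    exists a b, [/\ C = cls X R a, D = cls Y Q b & psat phi (join (sval a) (sval b))].
  have [a ->] := quotP C; have [b Yb Hb] := H1 _ (svalP a).
  by exists (cls Y Q (exist _ b Yb)), a, (exist _ b Yb).
exists F; split=> // a b.
have [a' [b' [/(cls_eq _ _ eR) Ea -> Hphi]]] := HF (cls X R a).
rewrite cls_eq //; apply: iff_sym.
apply: H2 Hphi; try exact: svalP.
by case: eR => _ + _; apply=> //; exact: svalP.
Qed.

End FormulaMaps.

Lemma induces_map_ext (A : structure) (m s : nat) (X : set (tup A m)) R (Y : set (tup A s)) Q
    phi psi (F : quot X R -> quot Y Q) :
  (forall a b, psat phi (join a b) <-> psat psi (join a b)) ->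
  induces_map phi F -> induces_map psi F.
Proof. by move=> H [F1 F2]; split=> a b; [rewrite F1 H|rewrite -H; apply: F2]. Qed.

Section FunctorOfInterpretation.
Variables (A B : structure) (i : interpretation A B) (gam : A -> tup B (dim (icode i))).
Hypothesis gamU : forall a, defU (icode i) B (ipar i) (gam a).
Hypothesis gamK : forall a, xcoord (i := i) (gam a) = a.
Let T := @ExtCode A B (icode i) (ipar i) gam.
Local Notation d := (dim (icode i)).
Local Notation U := (defU (icode i) B (ipar i)).
Local Notation mu := (xcoord (i := i)).

Lemma psat_translation (V : finType) W (s : V * 'I_d -> W) psi psi' (e : W -> B) :
  @is_translation A B T V W s psi psi' ->
  psat psi' e <-> (forall v, U (fun k => e (s (v, k)))) /\
                  psat psi (fun v => mu (fun k => e (s (v, k)))).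
Proof.
move=> [N HN ->]; rewrite /psat /= sat_rename.
have -> : join e (tconcat (tflat (gam \o pval psi)) (ipar i)) \o par_index s =
   blocks (join (fun v k => e (s (v, k))) (gam \o pval psi)) (ipar i).
  apply/funext => -[[[v|k] j]|l] //=; last by rewrite tconcat_rshift.
  rewrite tconcat_lshift.
  exact: (congr1 (fun f => f k j) (tflatK (gam \o pval psi))).
rewrite sat_translate -(HN A).
have -> : mu \o join (fun v k => e (s (v, k))) (gam \o pval psi) =
    join (fun v => mu (fun k => e (s (v, k)))) (pval psi).
  by apply/funext => -[//|k] /=; rewrite gamK.
split=> -[HU H]; split=> //; first by move=> v; apply: (HU (inl v)).
by move=> [v|k] /=; [apply: HU|apply: gamU].
Qed.

Definition inU m (b : tup B (m * d)) : Prop := forall k : 'I_m, U (tunflat b k).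
Definition mum m (b : tup B (m * d)) : tup A m := fun k => mu (tunflat b k).

Lemma mum_surj m (a : tup A m) : exists2 b, inU b & mum b = a.
Proof.
exists (tflat (gam \o a)).
  by rewrite /inU tflatK => k; apply: gamU.
by rewrite /mum tflatK; apply/funext => k; apply: gamK.
Qed.

Lemma psat_translation1 m psi psi' (b : tup B (m * d)) :
  @is_translation1 A B T m psi psi' -> psat psi' b <-> inU b /\ psat psi (mum b).
Proof. exact: psat_translation. Qed.

Lemma psat_translation2 m s psi psi' (b : tup B (m * d)) (c : tup B (s * d)) :
  @is_translation2 A B T m s psi psi' ->
  psat psi' (join b c) <-> [/\ inU b, inU c & psat psi (join (mum b) (mum c))].
Proof.
move=> H; rewrite (psat_translation _ H).
have -> : (fun v => mu (fun k => join b c (flat_index2 (v, k)))) = join (mum b) (mum c).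
  by apply/funext => -[].
split=> [[HU Hpsi]|[Hb Hc Hpsi]]; split=> //.
- by move=> k; apply: (HU (inl k)).
- by move=> k; apply: (HU (inr k)).
- by move=> [k|k]; [apply: Hb|apply: Hc].
Qed.

Lemma Vset_translation m S S' (b : tup B (m * d)) : S !=set0 ->
  @is_system_translation A B T m S S' -> Vset S' b <-> inU b /\ Vset S (mum b).
Proof.
move=> [psi0 S0] [tr Htr ->]; split=> [H|[Ub H] _ [psi Spsi <-]].
  split; first by have /(psat_translation1 _ (Htr _ S0))[] := H _ (ex_intro2 _ _ _ S0 erefl).
  move=> psi Spsi.
  by have /(psat_translation1 _ (Htr _ Spsi))[] := H _ (ex_intro2 _ _ _ Spsi erefl).
by apply/(psat_translation1 _ (Htr _ Spsi)); split=> //; apply: H.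
Qed.

Lemma pr_set' m (X : presentation T m) b :
  Vset (prS' X) b <-> inU b /\ Vset (prS X) (mum b).
Proof. exact: Vset_translation (pr_system X) (pr_transS X). Qed.

Lemma induces_translation m (X : presentation T m) E E' :
  is_translation2 (T := T) E E' -> induces_equiv (Vset (prS X)) E ->
  induces_equiv (Vset (prS' X)) E'.
Proof.
move=> HE [[rE sE tE] E2]; split; last first.
  move=> b b' /pr_set'[Ub Xb].
  rewrite !(psat_translation2 _ _ HE) => -[[_ Ub' Hb]|[Ub' _ Hb]].
    by apply/pr_set'; split=> //; apply: (E2 _ _ Xb); left.
  by apply/pr_set'; split=> //; apply: (E2 _ _ Xb); right.
split=> [b Xb|b b' Xb Xb'|b b' b2 Xb Xb' Xb2].
- split=> //; apply/(psat_translation2 _ _ HE).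
  by case/pr_set': Xb => Ub Xb; split=> //; have [] := rE _ Xb.
- move=> [_ _ /(psat_translation2 _ _ HE)[Ub Ub' H]]; split=> //.
  apply/(psat_translation2 _ _ HE).
  case/pr_set': Xb Xb' => _ Xb /pr_set'[_ Xb'].
  by split=> //; have [] := sE (mum b) (mum b') Xb Xb' (And3 Xb Xb' H).
- move=> [_ _ /(psat_translation2 _ _ HE)[Ub Ub' H]].
  move=> [_ _ /(psat_translation2 _ _ HE)[_ Ub2 H2]]; split=> //.
  apply/(psat_translation2 _ _ HE).
  case/pr_set': Xb Xb' Xb2 => _ Xb /pr_set'[_ Xb'] /pr_set'[_ Xb2]; split=> //.
  by have [] := tE (mum b) (mum b') (mum b2) Xb Xb' Xb2 (And3 Xb Xb' H) (And3 Xb' Xb2 H2).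
Qed.

Lemma defines_translation m s (X : presentation T m) (Y : presentation T s) phi phi' :
  is_translation2 (T := T) phi phi' ->
  defines_map (Vset (prS X)) (induced (Vset (prS X)) (prE X))
    (Vset (prS Y)) (induced (Vset (prS Y)) (prE Y)) phi ->
  defines_map (Vset (prS' X)) (induced (Vset (prS' X)) (prE' X))
    (Vset (prS' Y)) (induced (Vset (prS' Y)) (prE' Y)) phi'.
Proof.
move=> Hphi [H1 H2 H3]; split.
- move=> b /pr_set'[Ub Xb]; have [a Ya Hba] := H1 _ Xb.
  have [c Uc ac] := mum_surj a; rewrite -ac in Ya Hba.
  by exists c; [apply/pr_set'|apply/(psat_translation2 _ _ Hphi)].
- move=> b b' c c' Xb Xb' Yc Yc' [_ _ /(psat_translation2 _ _ (pr_transE X))[Ub Ub' Hbb']].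
  move=> /(psat_translation2 _ _ Hphi)[_ Uc Hbc].
  move: (Xb) (Xb') (Yc) (Yc') => /pr_set'[_ Xb0] /pr_set'[_ Xb0'] /pr_set'[_ Yc0].
  move=> /pr_set'[Uc' Yc0'].
  have H := H2 _ _ _ _ Xb0 Xb0' Yc0 Yc0' (And3 Xb0 Xb0' Hbb') Hbc.
  rewrite (psat_translation2 _ _ Hphi); split=> [[_ _ /H[_ _ Hcc']]|].
    by split=> //; apply/(psat_translation2 _ _ (pr_transE Y)).
  by move=> [_ _ /(psat_translation2 _ _ (pr_transE Y))[_ _ Hcc']]; split=> //; apply/H.
- move=> b c /pr_set'[Ub Xb] Yc /(psat_translation2 _ _ Hphi)[_ Uc Hbc].
  apply: (H3 _ _ Xb _ Hbc) => Yc0; apply: Yc; exact/pr_set'.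
Qed.

Lemma pr_equivq m (X : presentation T m) :
  equiv_on (Vset (prS X)) (induced (Vset (prS X)) (prE X)).
Proof. by have [] := pr_equiv X. Qed.

Lemma pr_equivq' m (X : presentation T m) :
  equiv_on (Vset (prS' X)) (induced (Vset (prS' X)) (prE' X)).
Proof. by have [] := induces_translation (pr_transE X) (pr_equiv X). Qed.

Lemma interp_functor_conditions : functor_conditions T.
Proof.
split.
- move=> m S S' neS tS; split=> [S0|S'0]; apply/seteqP; split=> // x.
    by move=> /(Vset_translation _ neS tS)[_]; rewrite S0.
  have [b Ub <-] := mum_surj x => Sx.
  suff : Vset S' b by rewrite S'0.
  exact/(Vset_translation _ neS tS).
- move=> m S1 S2 S1' S2' ne1 ne2 t1 t2 E12; apply/seteqP; split=> b.
    by move=> /(Vset_translation _ ne1 t1)[Ub]; rewrite E12 => H;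
      apply/(Vset_translation _ ne2 t2).
  by move=> /(Vset_translation _ ne2 t2)[Ub]; rewrite -E12 => H;
      apply/(Vset_translation _ ne1 t1).
- by move=> m X; apply: induces_translation (pr_transE X) (pr_equiv X).
- move=> m X E E' tE [e1 e2 e12]; split.
  + exact: induces_translation (pr_transE X) e1.
  + exact: induces_translation e2.
  + move=> b b' /pr_set'[Ub Xb] /pr_set'[Ub' Xb'].
    rewrite (psat_translation2 _ _ tE) (psat_translation2 _ _ (pr_transE X)).
    by split=> -[_ _ H]; split=> //; apply/(e12 _ _ Xb Xb').
- move=> m s X Y phi phi' tphi.
  rewrite (induces_map_ex (pr_equivq X) (pr_equivq Y)).
  rewrite (induces_map_ex (pr_equivq' X) (pr_equivq' Y)).
  exact: defines_translation.
- move=> m s X Y phi phi' psi psi' tphi tpsi [F [[Hphi H1] [Hpsi H2]]].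
  have [F' HF'] : exists F' : pr_quot' X -> pr_quot' Y, induces_map phi' F'.
    apply/(induces_map_ex (pr_equivq' X) (pr_equivq' Y)).
    apply: defines_translation tphi _.
    by apply/(induces_map_ex (pr_equivq X) (pr_equivq Y)); exists F.
  exists F'; split=> //; case: HF' => HF1 HF2.
  have E a b : Vset (prS X) a -> psat phi (join a b) <-> psat psi (join a b).
    move=> Xa; have [Yb|Yb] := pselect (Vset (prS Y) b).
      by rewrite -(Hphi (exist _ a Xa) (exist _ b Yb)) -(Hpsi (exist _ a Xa) (exist _ b Yb)).
    by split=> H; [case: (H1 _ _ Xa Yb)|case: (H2 _ _ Xa Yb)].
  have E' a b : Vset (prS' X) a -> psat phi' (join a b) <-> psat psi' (join a b).
    move=> /pr_set'[Ua Xa].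
    rewrite (psat_translation2 _ _ tphi) (psat_translation2 _ _ tpsi).
    by split=> -[? ? ?]; split=> //; apply/(E _ _ Xa).
  split=> [a b|a b Xa Yb]; first by rewrite HF1 E' //; apply: svalP.
  by rewrite -E' //; apply: HF2.
- move=> m s r X Y Z phi phi' psi psi' chi' tphi tpsi tchi _ _ F' G' HF HG.
  apply: (induces_map_ext _ (induces_map_comp HF HG)) => a c.
  rewrite (psat_pcomp phi' psi') (psat_translation2 _ _ tchi); split.
    move=> [b [/(psat_translation2 _ _ tphi)[Ua Ub H1] /(psat_translation2 _ _ tpsi)[_ Uc H2]]].
    by split=> //; apply/psat_pcomp; exists (mum b).
  move=> [Ua Uc /psat_pcomp[y [H1 H2]]]; have [b Ub by_] := mum_surj y; rewrite -by_ in H1 H2.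
  by exists b; rewrite (psat_translation2 _ _ tphi) (psat_translation2 _ _ tpsi).
Qed.

End FunctorOfInterpretation.

Arguments inU {A B} i {m} b.
Arguments mum {A B} i {m} b _.

Lemma fold1_foldr (T : eqType) (s : seq T) (I0 : Type) (f : T -> I0) l (P : I0 -> Prop) :
  fold1 or P (foldr (fun k l => More (f k) l) l s) <->
  (exists2 k, k \in s & P (f k)) \/ fold1 or P l.
Proof.
elim: s => [|x s IH] /=; first by split=> [|[[]//|//]]; right.
rewrite IH; split.
  case=> [H|[[k Hk H]|H]]; [left; exists x => //|left; exists k => //|by right].
    by rewrite mem_head.
  by rewrite inE Hk orbT.
case=> [[k]|H]; last by right; right.
by rewrite inE => /orP[/eqP->|Hk] H; [left|right; left; exists k].
Qed.

Section InterpretationOfFunctor.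
Variables (A B : structure) (T : extcode A B).
Hypothesis fc : functor_conditions T.
Local Notation G := (ecode T).
Local Notation p := (epar T).
Local Notation d := (dim G).
Local Notation U := (defU G B p).
Local Notation E := (defE G B p).
Local Notation gam := (egamma T).

Lemma psat_ptranslate (m n : nat) (N : nform _ ('I_m + 'I_n)) a (b : tup B (m * d)) :
  psat (ptranslate (@flat_index m d) N a) b <->
  (forall k, U (tunflat b k)) /\ (forall k, U (gam (a k))) /\
  sat (blocks (join (tunflat b) (gam \o a)) p) (tr_body G N).
Proof.
rewrite /psat /= sat_rename.
have -> : join b (tconcat (tflat (gam \o a)) p) \o par_index (@flat_index m d) =
   blocks (join (tunflat b) (gam \o a)) p.
  apply/funext => -[[[v|k] j]|l] //=; last by rewrite tconcat_rshift.
  rewrite tconcat_lshift.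
  exact: (congr1 (fun f => f k j) (tflatK (gam \o a))).
rewrite sat_translate_body; split=> [[H1 H2]|[H1 [H2 H3]]].
  split; first by move=> k; apply: (H1 (inl k)).
  by split=> // k; apply: (H1 (inr k)).
by split=> // -[].
Qed.

Definition pnf m n (N : nform (lang A) ('I_m + 'I_n)) (a : tup A n) : pformula A 'I_m :=
  @PFormula A 'I_m n (nf_formula N) a.

Lemma pnf_translation m n (N : nform (lang A) ('I_m + 'I_n)) (a : tup A n) :
  is_translation1 (T := T) (pnf N a) (ptranslate (@flat_index m d) N a).
Proof. by exists N. Qed.

Lemma single_translation m psi psi' : is_translation1 (T := T) (m := m) psi psi' ->
  is_system_translation (T := T) [set psi] [set psi'].
Proof.
by move=> H; exists (fun=> psi') => [_ -> //|]; rewrite image_set1.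
Qed.

Lemma single_nonempty C m (psi : pformula C 'I_m) : [set psi] !=set0.
Proof. by exists psi. Qed.

Lemma Vset1 C m (psi : pformula C 'I_m) a : Vset [set psi] a <-> psat psi a.
Proof. by split=> [/(_ psi erefl)//|H _ ->]. Qed.

Lemma gam_E a a' : [/\ U (gam a), U (gam a') & E (gam a) (gam a')] <-> a = a'.
Proof.
pose N : nform (lang A) ('I_0 + 'I_2) :=
  Matrix (One (One (true, UEq (inr ord0) (inr ord_max)))).
pose c : tup A 2 := fun k => if k == ord0 then a else a'.
have H := fc1 fc (single_nonempty (pnf N c)) (single_translation (pnf_translation N c)).
have HA e : Vset [set pnf N c] e <-> a = a' by rewrite Vset1.
have HB e : Vset [set ptranslate (@flat_index 0 d) N c] e <->
    [/\ U (gam a), U (gam a') & E (gam a) (gam a')].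
  rewrite Vset1 psat_ptranslate /= sat_rename blocks_onblocks.
  have -> : join (tunflat e) (gam \o c) \o (fun k : bool => if k then inr ord_max else inr ord0)
     = fun k : bool => if k then gam a' else gam a by apply/funext => -[].
  split=> [[_ [HU HE]]|[H1 H2 H3]].
    by split=> //; [apply: (HU ord0)|apply: (HU ord_max)].
  by split=> [[]//|]; split=> // k; rewrite /c; case: ifP.
split=> H0.
  apply: contrapT => aa'.
  have /H/seteqP[] : Vset [set pnf N c] = set0.
    by apply/seteqP; split=> // e /HA.
  by move=> /(_ (fun k => ord0_elim B (cast_ord (mul0n d) k))) + _; apply; apply/HB.
apply: contrapT => nH.
have /H/seteqP[] : Vset [set ptranslate (@flat_index 0 d) N c] = set0.
  by apply/seteqP; split=> // e /HB.
by move=> /(_ (@ord0_elim A)) + _; apply; apply/HA.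
Qed.

Lemma gam_U a : U (gam a).
Proof. by have [] := (gam_E a a).2 erefl. Qed.

Lemma E_tr V (x x' : V) (b : V -> tup B d) :
  sat (blocks b p) (tr_unnested G (UEq x x')) <-> E (b x) (b x').
Proof.
rewrite /= sat_rename blocks_onblocks.
by rewrite (_ : b \o _ = fun j : bool => if j then b x' else b x) //;
  apply/funext => -[].
Qed.

Lemma gam_surj b : U b -> exists a, E b (gam a).
Proof.
move=> Ub; apply: contrapT => /forallNP nE.
pose N : nform (lang A) ('I_1 + 'I_1) :=
  Matrix (One (One (false, UEq (inl ord0) (inr ord0)))).
pose c a : tup A 1 := fun=> a.
pose S : set (pformula A 'I_1) := [set pnf N (c a) | a in setT].
have /choice[tr Htr] psi : exists psi' : pformula B 'I_(1 * d),
    S psi -> exists2 a, psi = pnf N (c a) & psi' = ptranslate (@flat_index 1 d) N (c a).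
  have [[a _ <-]|nS] := pselect (S psi); last by exists (ptrue B _).
  by exists (ptranslate (@flat_index 1 d) N (c a)); exists a.
have tS : is_system_translation (T := T) S (tr @` S).
  exists tr => // psi /Htr[a -> ->]; exact: pnf_translation.
have neS : S !=set0.
  by have [a _] := model_nonempty A; exists (pnf N (c a)), a.
have /(fc1 fc neS tS)/seteqP[+ _] : Vset S = set0.
  apply/seteqP; split=> // e He.
  by have := He _ (ex_intro2 _ _ (e ord0) I erefl); apply.
move=> /(_ (tflat (fun=> b)))+; apply.
move=> _ [psi /Htr[a _ ->] <-]; apply/psat_ptranslate; rewrite tflatK.
split=> //; split=> [k|]; first exact: gam_U.
by rewrite /= /dnf_formula; move=> /E_tr; apply: nE.
Qed.

Lemma atom_transfer1 sg m (at_ : unnested (lang A) 'I_m) (b : 'I_m -> tup B d) (a : tup A m) :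
  (forall k, U (b k)) -> (forall k, E (b k) (gam (a k))) ->
  sat a (signed sg (unnested_formula at_)) ->
  sat (blocks b p) (signed sg (tr_unnested G at_)).
Proof.
move=> Ub Ea Hat.
pose at' : unnested (lang A) ('I_m + 'I_m) := unnested_rename inl at_.
pose N : nform (lang A) ('I_m + 'I_m) := Matrix (foldr
  (fun k l => More (One (false, UEq (inl k) (inr k))) l) (One (One (sg, at'))) (enum 'I_m)).
pose N0 : nform (lang A) ('I_m + 'I_m) :=
  Matrix (More (One (true, at')) (One (One (false, at')))).
have E01 : Vset [set pnf N0 a] = Vset [set pnf N a].
  apply/seteqP; split=> e _; apply/Vset1; rewrite /psat /=.
    rewrite sat_dnf /dsat fold1_foldr.
    have [[k Hk]|/forallNP Hk] := pselect (exists k, e k <> a k).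
      by left; exists k; first exact: mem_enum.
    right; rewrite /= sat_signed.
    have -> : e = a by apply/funext => k; apply: contrapT.
    by case: sg {N} Hat => /=; rewrite sat_unnested_rename.
  exact: EM.
have E01' := fc2 fc (single_nonempty _) (single_nonempty _)
  (single_translation (pnf_translation N0 a)) (single_translation (pnf_translation N a)) E01.
have : Vset [set ptranslate (@flat_index m d) N0 a] (tflat b).
  apply/Vset1/psat_ptranslate; rewrite tflatK; split=> //.
  split=> [k|]; first exact: gam_U.
  exact: EM.
rewrite E01' => /Vset1/psat_ptranslate[_ [_]]; rewrite tflatK /= sat_dnf /dsat fold1_foldr.
case=> [[k _] nE|]; first by case: nE; apply/E_tr/Ea.
have tr' : sat (blocks (join b (gam \o a)) p) (tr_unnested G at') <->
    sat (blocks b p) (tr_unnested G at_).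
  rewrite /at'; case: at_ {Hat at' N N0 E01 E01'} => [x x'|x c|f xs x0|r xs] /=;
    rewrite !sat_rename !blocks_onblocks;
    match goal with |- sat (blocks ?x p) _ <-> sat (blocks ?y p) _ =>
      by have -> : x = y by apply/funext => -[] end.
by rewrite /= !sat_signed; case: sg {N Hat E01 E01'}; rewrite tr'.
Qed.

Lemma atom_transfer m (at_ : unnested (lang A) 'I_m) (b : 'I_m -> tup B d) (a : tup A m) :
  (forall k, U (b k)) -> (forall k, E (b k) (gam (a k))) ->
  sat (blocks b p) (tr_unnested G at_) <-> sat a (unnested_formula at_).
Proof.
move=> Ub Ea; split=> H; last exact: (@atom_transfer1 true m at_ b a Ub Ea).
apply: contrapT => nH.
exact: (@atom_transfer1 false m at_ b a Ub Ea).
Qed.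

(* The coordinate map sends a tuple equivalent to [gamma(a)] to [a]. *)
Definition nu (b : tup B d) : A :=
  match pselect (U b) with
  | left Ub => sval (cid (gam_surj Ub))
  | right _ => sval (cid (model_nonempty A))
  end.

Lemma nuP b : U b -> E b (gam (nu b)).
Proof. by rewrite /nu; case: pselect => // Ub _; exact: (svalP (cid (gam_surj Ub))). Qed.

Lemma nu_gam a : nu (gam a) = a.
Proof.
apply/esym/gam_E; split; [exact: gam_U..|].
exact/nuP/gam_U.
Qed.

Lemma nu_surj a : exists2 b, U b & nu b = a.
Proof. by exists (gam a); [apply: gam_U|apply: nu_gam]. Qed.

Lemma nu_E b b' : U b -> U b' -> E b b' <-> nu b = nu b'.
Proof.
move=> Ub Ub'.
pose bs : 'I_2 -> tup B d := fun k => if k == ord0 then b else b'.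
have := @atom_transfer 2 (UEq ord0 ord_max) bs (nu \o bs).
rewrite E_tr /=; apply=> k; rewrite /bs; case: ifP => //= _; exact: nuP.
Qed.

Lemma nu_c c b : U b -> defc G B p c b <-> nu b = cinterp A c.
Proof.
move=> Ub.
have := @atom_transfer 1 (UCst ord0 c) (fun=> b) (fun=> nu b).
by rewrite /= sat_rename blocks_onblocks /=; apply=> // _; apply: nuP.
Qed.

Lemma nu_f f b0 bs : U b0 -> (forall k, U (bs k)) ->
  deff G B p f b0 bs <-> finterp A f (nu \o bs) = nu b0.
Proof.
move=> Ub0 Ubs.
pose cs : 'I_(farity f).+1 -> tup B d := fun k => push bs b0 (unlift ord0 k).
have := @atom_transfer _ (UFun f (lift ord0) ord0) cs (nu \o cs).
rewrite /= sat_rename blocks_onblocks /=.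
have -> : cs \o push (lift ord0) ord0 = push bs b0.
  by apply/funext => -[k|]; rewrite /= /cs ?liftK ?unlift_none.
have -> : nu (cs ord0) = nu b0 by rewrite /cs unlift_none.
have -> : (fun k => nu (cs (lift ord0 k))) = nu \o bs.
  by apply/funext => k; rewrite /cs liftK.
apply=> k; rewrite /cs; case: (unlift ord0 k) => [l|] //=; exact: nuP.
Qed.

Lemma nu_r r bs : (forall k, U (bs k)) ->
  defr G B p r bs <-> rinterp A r (nu \o bs).
Proof.
move=> Ubs; have := @atom_transfer _ (URel r id) bs (nu \o bs).
rewrite /= sat_rename blocks_onblocks /=; apply=> // k; exact: nuP.
Qed.

Definition interp_of_functor : interpretation A B :=
  make_interp nu_surj nu_E nu_c nu_f nu_r.

Lemma interp_of_functor_gam a : xcoord (i := interp_of_functor) (gam a) = a.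
Proof. by rewrite make_interp_xcoord; [apply: nu_gam|apply: gam_U]. Qed.

End InterpretationOfFunctor.

Definition ttup (A : Type) : Type := {m : nat & tup A m}.

Lemma ttup_inv A m m' (a : tup A m) (a' : tup A m') :
  existT (tup A) m a = existT (tup A) m' a' -> exists e : m = m', tcast e a = a'.
Proof.
move=> H; have e : m = m' := congr1 (@projT1 _ _) H.
case: _ / e a' H => a' H; exists erefl.
by rewrite tcast1; apply: existT_inj2 H.
Qed.

Lemma ttup_cast A m m' (e : m = m') (a : tup A m) :
  existT (tup A) m' (tcast e a) = existT (tup A) m a.
Proof. by case: _ / e; rewrite tcast1. Qed.

Lemma ttup_inj A m (a a' : tup A m) : existT (tup A) m a = existT (tup A) m a' -> a = a'.
Proof. by move/ttup_inv => [e]; rewrite tcast1. Qed.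

Section Relations.
Variable A : structure.

Definition obj_rel (X : option (pls A)) (x y : ttup A) : Prop :=
  if X is Some X then exists a b,
    [/\ x = existT _ (pls_arity X) a, y = existT _ (pls_arity X) b & @pls_rel _ X a b]
  else False.

Definition map_rel (X Y : option (pls A)) : pls_hom X Y -> ttup A -> ttup A -> Prop :=
  match X, Y with
  | Some X, Some Y => fun f x y =>
    exists (a : {a | @pls_set _ X a}) (b : {b | @pls_set _ Y b}),
      [/\ x = existT _ (pls_arity X) (sval a), y = existT _ (pls_arity Y) (sval b)
        & sval f (cls _ _ a) = cls _ _ b]
  | _, _ => fun _ _ _ => False
  end.

Lemma pls_rel_set (X : pls A) a : @pls_set _ X a <-> @pls_rel _ X a a.
Proof.
have [E [[rE _ _] _] ->] := pls_equiv X.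
by split=> [/rE//|[]].
Qed.

Lemma pls_eq (X Y : pls A) (e : pls_arity X = pls_arity Y) :
  (forall a b, @pls_rel _ X a b <-> @pls_rel _ Y (tcast e a) (tcast e b)) -> X = Y.
Proof.
move=> H.
have HS a : @pls_set _ X a <-> @pls_set _ Y (tcast e a) by rewrite !pls_rel_set H.
case: X Y e H HS => m X R X1 X2 X3 [m' Y Q Y1 Y2 Y3] /= e.
case: _ / e Y Q Y1 Y2 Y3 => Y Q Y1 Y2 Y3 H HS.
have XY : X = Y by apply/seteqP; split=> a; rewrite HS tcast1.
have RQ : R = Q.
  by apply/funext => a; apply/funext => b; apply/propext; rewrite H !tcast1.
case: _ / XY Y1 Y2 Y3 {HS} => Y1 Y2 Y3; case: _ / RQ Y3 {H} => Y3.
by congr Pls; apply: Prop_irrelevance.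
Qed.

Lemma obj_rel_inj (X Y : option (pls A)) : obj_rel X = obj_rel Y -> X = Y.
Proof.
case: X Y => [X|] [Y|] // H.
- have [a Xa] := @pls_nonempty _ X.
  have : obj_rel (Some X) (existT _ _ a) (existT _ _ a).
    by exists a, a; split=> //; apply/pls_rel_set.
  rewrite H => -[a' [_ [/ttup_inv[e _] _ _]]]; congr Some.
  apply: (@pls_eq _ _ e) => b c; split=> Hbc.
    have : obj_rel (Some X) (existT _ _ b) (existT _ _ c) by exists b, c.
    rewrite H => -[b' [c' [Eb Ec]]].
    rewrite -(ttup_cast e) in Eb; rewrite -(ttup_cast e) in Ec.
    by rewrite (ttup_inj Eb) (ttup_inj Ec).
  have : obj_rel (Some Y) (existT _ _ (tcast e b)) (existT _ _ (tcast e c)).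
    by exists (tcast e b), (tcast e c).
  rewrite -H !ttup_cast => -[b' [c' [Eb Ec]]].
  by rewrite (ttup_inj Eb) (ttup_inj Ec).
- have [a Xa] := @pls_nonempty _ X.
  have : obj_rel (Some X) (existT _ _ a) (existT _ _ a).
    by exists a, a; split=> //; apply/pls_rel_set.
  by rewrite H.
- have [a Ya] := @pls_nonempty _ Y.
  have : obj_rel (Some Y) (existT _ _ a) (existT _ _ a).
    by exists a, a; split=> //; apply/pls_rel_set.
  by rewrite -H.
Qed.

Lemma map_rel_inj (X Y : option (pls A)) (f g : pls_hom X Y) :
  map_rel f = map_rel g -> f = g.
Proof.
case: X Y f g => [X|] [Y|] f g; try by [case: f|case: f; case: g].
move=> H; apply: formula_map_eq; apply/funext => C; have [a ->] := quotP C.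
have [b Hb] := quotP (sval f (cls _ _ a)); rewrite Hb; apply/esym.
have : @map_rel (Some X) (Some Y) f (existT _ _ (sval a)) (existT _ _ (sval b)) by exists a, b.
rewrite H => -[a' [b' [/ttup_inj Ea /ttup_inj Eb]]].
have -> : a' = a by case: a a' Ea {H Hb} => [a Ha] [a' Ha'] /= Ea; apply: eq_exist.
by have -> : b' = b by case: b b' Eb {H Hb} => [b Hb] [b' Hb'] /= Eb; apply: eq_exist.
Qed.
End Relations.

Lemma functor_eq (A B : structure) (F F' : functor (PLS A) (PLS B)) :
  (forall X, obj_rel (fobj F X) = obj_rel (fobj F' X)) ->
  (forall X Y (f : pls_hom X Y), map_rel (fmap F f) = map_rel (fmap F' f)) ->
  F = F'.
Proof.
case: F F' => [o m m1 mM] [o' m' m1' mM'] /= Ho Hm.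
have oo' : o = o' by apply/funext => X; apply: obj_rel_inj.
clear Ho; case: _ / oo' m' m1' mM' Hm => m' m1' mM' Hm.
have mm' : m = m'.
  apply/functional_extensionality_dep => X; apply/functional_extensionality_dep => Y.
  by apply/funext => f; apply: map_rel_inj.
clear Hm; case: _ / mm' m1' mM' => m1' mM'.
by congr Functor; apply: Prop_irrelevance.
Qed.

Section Lifting.
Variables (A B : Type) (g : {d & tup B d -> A -> Prop}).

Definition glift (y : ttup B) (x : ttup A) : Prop :=
  exists b : tup B (projT1 x * projT1 g),
    y = existT _ _ b /\ forall k, projT2 g (tunflat b k) (projT2 x k).

Definition pullback (R : ttup A -> ttup A -> Prop) (y y' : ttup B) : Prop :=
  exists x x', [/\ glift y x, glift y' x' & R x x'].
End Lifting.

Lemma glift_comp A B C (g : {d & tup B d -> A -> Prop}) (h : {d & tup C d -> B -> Prop})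
    (z : ttup C) (x : ttup A) :
  glift (graph_comp g h) z x <-> exists2 y, glift h z y & glift g y x.
Proof.
case: g h x => [m g] [n h] [l a]; rewrite /glift /=.
have E (c : tup C (l * (m * n))) (u : 'I_l) (v : 'I_m) :
    tunflat (tunflat c u) v = tunflat (tcast (mulnA l m n) c) (flat_index (u, v)).
  apply/funext => w; congr c; apply: val_inj => /=.
  by rewrite mulnDl mulnA addnA.
split=> [[c [-> Hc]]|[y [c [-> Hc]] [b [Eb Hb]]]].
  have /choice[b Hb] k : exists b : tup B m,
      (forall u, h (tunflat (tunflat c k) u) (b u)) /\ g b (a k).
    by have [b Hb Hg] := Hc k; exists b.
  exists (existT _ (l * m) (tflat b)).
    exists (tcast (mulnA l m n) c); rewrite ttup_cast; split=> //= k.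
    rewrite -[k in tunflat _ k]flat_rowK -E.
    by have [] := Hb (flat_row k).
  by exists (tflat b); split=> // k; rewrite tflatK; have [] := Hb k.
move: c Hc; rewrite {y}Eb /= => c Hc.
exists (tcast (esym (mulnA l m n)) c); rewrite ttup_cast; split=> // k.
exists (tunflat b k) => // u.
rewrite E; have -> : tcast (mulnA l m n) (tcast (esym (mulnA l m n)) c) = c.
  by apply/funext => w; congr c; apply: val_inj.
exact: Hc.
Qed.

Lemma glift_id A (y x : ttup A) : glift (graph_id A) y x <-> y = x.
Proof.
case: x => m a; rewrite /glift /=.
have E (b : tup A (m * 1)) (k : 'I_m) : tunflat b k ord0 = tcast (muln1 m) b k.
  by congr b; apply: val_inj; rewrite /= muln1 addn0.
split=> [[b [-> Hb]]|->].
  rewrite -(ttup_cast (muln1 m)); congr existT; apply/funext => k.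
  by rewrite -E Hb.
exists (tcast (esym (muln1 m)) a); rewrite ttup_cast; split=> // k.
by rewrite E; congr a; apply: val_inj.
Qed.

Lemma pullback_comp A B C (g : {d & tup B d -> A -> Prop}) (h : {d & tup C d -> B -> Prop}) R :
  pullback (graph_comp g h) R = pullback h (pullback g R).
Proof.
apply/funext => z; apply/funext => z'; apply/propext; split.
  move=> [x [x' [/glift_comp[y zy yx] /glift_comp[y' zy' yx'] H]]].
  by exists y, y'; split=> //; exists x, x'.
move=> [y [y' [zy zy' [x [x' [yx yx' H]]]]]].
by exists x, x'; split=> //; apply/glift_comp; [exists y|exists y'].
Qed.

Lemma pullback_id A R : pullback (graph_id A) R = R.
Proof.
apply/funext => z; apply/funext => z'; apply/propext; split.
  by move=> [x [x' [/glift_id -> /glift_id ->]]].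
by move=> H; exists z, z'; split=> //; apply/glift_id.
Qed.

(* The functor [F] acts by taking preimages under the coordinate map with graph [g]. *)
Definition acts_by (A B : structure) (g : {d & tup B d -> A -> Prop})
    (F : functor (PLS A) (PLS B)) : Prop :=
  (forall X, obj_rel (fobj F X) = pullback g (obj_rel X)) /\
  (forall X Y (f : pls_hom X Y), map_rel (fmap F f) = pullback g (map_rel f)).

Lemma acts_by_inj (A B : structure) (g : {d & tup B d -> A -> Prop})
    (F F' : functor (PLS A) (PLS B)) :
  acts_by g F -> acts_by g F' -> F = F'.
Proof.
by move=> [H1 H2] [H1' H2']; apply: functor_eq => *; rewrite ?H1 ?H1' ?H2 ?H2'.
Qed.

Lemma acts_by_comp (A B C : structure) (g : {d & tup B d -> A -> Prop})
    (h : {d & tup C d -> B -> Prop}) (F : functor (PLS A) (PLS B)) (F' : functor (PLS B) (PLS C)) :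
  acts_by g F -> acts_by h F' -> acts_by (graph_comp g h) (functor_comp F' F).
Proof.
move=> [H1 H2] [H1' H2']; split=> [X|X Y f] /=; rewrite pullback_comp.
  by rewrite H1' H1.
by rewrite -H2; apply: H2'.
Qed.

Lemma acts_by_id (A : structure) : acts_by (graph_id A) (functor_id (PLS A)).
Proof. by split=> *; rewrite pullback_id. Qed.

Section ActsBy.
Variables (A B : structure) (i : interpretation A B) (gam : A -> tup B (dim (icode i))).
Hypothesis gamU : forall a, defU (icode i) B (ipar i) (gam a).
Hypothesis gamK : forall a, xcoord (i := i) (gam a) = a.
Let T := @ExtCode A B (icode i) (ipar i) gam.
Hypothesis fc : functor_conditions T.

Lemma glift_graph (y : ttup B) m (a : tup A m) :
  glift (graph i) y (existT _ m a) <->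
  exists b : tup B (m * dim (icode i)),
    [/\ y = existT _ _ b, inU i b & mum i b = a].
Proof.
split=> [[b [-> Hb]]|[b [-> Ub <-]]].
  have Hb' k : defU (icode i) B (ipar i) (tunflat b k) /\
    xcoord (i := i) (tunflat b k) = a k := Hb k.
  exists b; split=> //; first by move=> k; have [] := Hb' k.
  by apply/funext => k; have [] := Hb' k.
exists b; split=> //= k; split=> //; exact: Ub.
Qed.

Lemma acts_by_interp : acts_by (graph i) (interpretation_functor fc).
Proof.
have SX (X : pls A) b : Vset (prS' (pls_pres T X)) b <-> inU i b /\ @pls_set _ X (mum i b).
  by rewrite (pr_set' gamU gamK) pls_pres_set.
split.
  case=> [X|]; apply/funext => y; apply/funext => y'; apply/propext; last first.
    by split=> // -[x [x' []]].
  have Hrel b b' : @pls_rel _ (tr_obj fc X) b b' <->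
      [/\ inU i b, inU i b' & @pls_rel _ X (mum i b) (mum i b')].
    rewrite -(pls_pres_rel T); split.
      move=> [/(pr_set' gamU gamK)[Ub Xb] /(pr_set' gamU gamK)[Ub' Xb']].
      by move=> /(psat_translation2 gamU gamK _ _ (pr_transE _))[_ _ H].
    move=> [Ub Ub' [Xb Xb' H]]; split.
    + exact/(pr_set' gamU gamK).
    + exact/(pr_set' gamU gamK).
    + exact/(psat_translation2 gamU gamK _ _ (pr_transE _)).
  split=> [[b [b' [-> ->]]]|].
    move=> /Hrel[Ub Ub' H].
    exists (existT _ _ (mum i b)), (existT _ _ (mum i b')); split.
    + by apply/glift_graph; exists b.
    + by apply/glift_graph; exists b'.
    + by exists (mum i b), (mum i b').
  move=> [x [x' [gx gx' [a [a' [Ex Ex' H]]]]]].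
  move: gx gx'; rewrite {x}Ex {x'}Ex'.
  move=> /glift_graph[b [-> Ub Eb]] /glift_graph[b' [-> Ub' Eb']].
  by exists b, b'; split=> //; apply/Hrel; rewrite Eb Eb'.
case=> [X|] [Y|] f; try by
  apply/funext => y; apply/funext => y'; apply/propext; split=> // -[x [x' []]].
have Hmap (b : {b | @pls_set _ (tr_obj fc X) b}) (c : {b | @pls_set _ (tr_obj fc Y) b})
    (Xb : @pls_set _ X (mum i (sval b))) (Yc : @pls_set _ Y (mum i (sval c))) :
    sval (tr_map fc f) (cls _ _ b) = cls _ _ c <->
    sval f (cls _ _ (exist _ _ Xb)) = cls _ _ (exist _ _ Yc).
  have [phi Hphi] := svalP f.
  have [phi' Hphi'] := translation_ex (T := T) (@flat_index2 _ _ _) phi.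
  have [H1 _] := tr_mapP fc Hphi Hphi'; have [H2 _] := Hphi.
  rewrite H1 H2 /= (psat_translation2 gamU gamK _ _ Hphi').
  have /SX[Ub _] := svalP b; have /SX[Uc _] := svalP c.
  by split=> [[]|].
apply/funext => y; apply/funext => y'; apply/propext; split.
  move=> [b [c [-> -> /=]]].
  have /SX[Ub Xb] := svalP b; have /SX[Uc Yc] := svalP c.
  rewrite (Hmap b c Xb Yc) => H.
  exists (existT _ _ (mum i (sval b))), (existT _ _ (mum i (sval c))); split.
  + by apply/glift_graph; exists (sval b).
  + by apply/glift_graph; exists (sval c).
  + by exists (exist _ _ Xb), (exist _ _ Yc).
move=> [x [x' [gx gx' [[a Xa] [[c Yc] [/= Ex Ex' H]]]]]].
move: gx gx'; rewrite {x}Ex {x'}Ex'.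
move=> /glift_graph[b [-> Ub Eb]] /glift_graph[b' [-> Ub' Eb']].
case: _ / Eb in Xa H; case: _ / Eb' in Yc H.
have Xb : @pls_set _ (tr_obj fc X) b by apply/SX.
have Yb' : @pls_set _ (tr_obj fc Y) b' by apply/SX.
exists (exist _ b Xb), (exist _ b' Yb'); split=> //=.
exact/(Hmap (exist _ b Xb) (exist _ b' Yb') Xa Yc).
Qed.
End ActsBy.

Lemma interp_functor_ex A B (i : interpretation A B) :
  exists2 F, is_interpretation_functor F & acts_by (graph i) F.
Proof.
pose gam (a : A) := icoord_inv i (fun _ : 'I_1 => a) ord0.
have gamU a : defU (icode i) B (ipar i) (gam a) by apply: icoord_invU.
have gamK a : xcoord (i := i) (gam a) = a.
  exact: (congr1 (fun f => f ord0) (icoord_invK i (fun _ : 'I_1 => a))).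
exists (interpretation_functor (interp_functor_conditions gamU gamK)).
  by exists (ExtCode (ipar i) gam), (interp_functor_conditions gamU gamK).
exact: acts_by_interp.
Qed.

Lemma functor_interp_ex A B (F : functor (PLS A) (PLS B)) :
  is_interpretation_functor F -> exists i : interpretation A B, acts_by (graph i) F.
Proof.
move=> [[G p gam] [fc ->]]; exists (interp_of_functor fc).
by apply: acts_by_interp; [apply: (gam_U fc)|apply: (interp_of_functor_gam fc)].
Qed.

Lemma is_interpretation_functor_id A : is_interpretation_functor (functor_id (PLS A)).
Proof.
have [F HF] := interp_functor_ex (interp_id A); rewrite graph_interp_id => HF'.
by rewrite (acts_by_inj (acts_by_id A) HF').
Qed.

Lemma is_interpretation_functor_comp A B C (F' : functor (PLS B) (PLS C))
    (F : functor (PLS A) (PLS B)) :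
  is_interpretation_functor F' -> is_interpretation_functor F ->
  is_interpretation_functor (functor_comp F' F).
Proof.
move=> /functor_interp_ex[j Hj] /functor_interp_ex[i Hi].
have [H HH] := interp_functor_ex (interp_comp i j); rewrite graph_interp_comp => HH'.
by rewrite (acts_by_inj (acts_by_comp Hi Hj) HH').
Qed.

Definition PLG_hom (A B : structure) : Type :=
  {F : functor (PLS A) (PLS B) | is_interpretation_functor F}.

Definition PLG_id (A : structure) : PLG_hom A A :=
  exist _ (functor_id (PLS A)) (is_interpretation_functor_id A).

Definition PLG_comp (A B C : structure) (G : PLG_hom B C) (F : PLG_hom A B) : PLG_hom A C :=
  exist _ (functor_comp (sval G) (sval F))
    (is_interpretation_functor_comp (svalP G) (svalP F)).

Lemma functor_comp_id C D (F : functor C D) : functor_comp F (functor_id C) = F.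
Proof. by case: F => o m m1 mM; congr Functor; apply: Prop_irrelevance. Qed.

Lemma functor_id_comp C D (F : functor C D) : functor_comp (functor_id D) F = F.
Proof. by case: F => o m m1 mM; congr Functor; apply: Prop_irrelevance. Qed.

Lemma functor_compA C D E E' (H : functor E E') (G : functor D E) (F : functor C D) :
  functor_comp H (functor_comp G F) = functor_comp (functor_comp H G) F.
Proof. by congr Functor; apply: Prop_irrelevance. Qed.

Lemma PLG_comp1 A B (F : PLG_hom A B) : PLG_comp F (PLG_id A) = F.
Proof. by case: F => F HF; apply: eq_exist; apply: functor_comp_id. Qed.

Lemma PLG_1comp A B (F : PLG_hom A B) : PLG_comp (PLG_id B) F = F.
Proof. by case: F => F HF; apply: eq_exist; apply: functor_id_comp. Qed.

Lemma PLG_compA A B C D (H : PLG_hom C D) (G : PLG_hom B C) (F : PLG_hom A B) :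
  PLG_comp H (PLG_comp G F) = PLG_comp (PLG_comp H G) F.
Proof. by apply: eq_exist; apply: functor_compA. Qed.

(* The object [A] stands for the category [PLS A]. *)
Definition PLG : category := {|
  obj := structure;
  hom := PLG_hom;
  idc := PLG_id;
  compc := PLG_comp;
  compc1 := PLG_comp1;
  comp1c := PLG_1comp;
  compcA := PLG_compA |}.

(* Main.v *)
From mathcomp Require Import all_boot.
From mathcomp Require Import boolp classical_sets.
Require Import Defs.

(** Both categories are shown to be, hom-set by hom-set, the same category of
    graphs of coordinate maps.

    On the side of interpretations, two interpretations of [A] in [B] are equal
    exactly when their coordinate maps have the same graph, a relation between
    tuples of [B] of some fixed length and elements of [A].  On the side of
    functors, an interpretation functor replaces every definable set, equivalence
    and map over [A] by its preimage under a coordinate map; so the functor is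
    determined by the graph of that map.

    What remains is the converse: the graph can be read off from the functor.  It
    suffices to look at the one-point objects.  A singleton [{a}] is a logical
    set, defined by the formula [x = a] with a constant naming [a], and its image
    under the functor is the fibre of the coordinate map over [a]
    ([pullback_singleton]).  Since coordinate maps are surjective, the fibres are
    non-empty, so they also determine the length of the tuples
    ([acts_by_graph_inj]).

    Hence [class of i |-> functor acting by the graph of i] is a bijection on
    hom-sets, and it respects identities and composition because graphs of
    coordinate maps compose in the same way as taking preimages does. *)

Set Implicit Arguments.
Unset Strict Implicit.
Unset Printing Implicit Defensive.

Local Open Scope classical_set_scope.

Section SingletonObject.
Variables (A : structure) (a : A).

Definition singleton_system : set (pformula A 'I_1) :=
  [set @PFormula A _ 1 (Eq (Var (inl ord0)) (Var (inr ord0))) (fun=> a)].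

Definition singleton_equality : pformula A ('I_1 + 'I_1) :=
  @PFormula A _ 0 (Eq (Var (inl (inl ord0))) (Var (inl (inr ord0))))
    (@ord0_elim A).

Lemma singleton_set (x : tup A 1) : Vset singleton_system x <-> x ord0 = a.
Proof. by split=> [H|xa _ ->]; [apply: (H _ erefl)|]. Qed.

Lemma singleton_nonempty : Vset singleton_system !=set0.
Proof. by exists (fun=> a); apply/singleton_set. Qed.

Lemma singleton_equiv : induces_equiv (Vset singleton_system) singleton_equality.
Proof.
split; first by split=> [x Xx|x y _ _ [Xx Xy xy]|x y z _ _ _ [Xx Xy xy] [_ Xz yz]];
  split=> //; rewrite /psat /= ?xy //; rewrite /psat /= in xy yz; rewrite xy.
move=> x y /singleton_set xa [] xy; apply/singleton_set; rewrite -xa;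
  by rewrite /psat /= in xy.
Qed.

Definition singleton_pls : pls A :=
  Pls singleton_nonempty (ex_intro _ singleton_system erefl)
    (ex_intro2 _ _ singleton_equality singleton_equiv erefl).

Lemma singleton_obj_rel (x y : ttup A) :
  obj_rel (Some singleton_pls) x y <->
  x = existT _ 1 (fun=> a) /\ y = existT _ 1 (fun=> a).
Proof.
have point (c : tup A 1) : c ord0 = a -> c = fun=> a.
  by move=> ca; apply/funext => k; rewrite ord1.
split=> [[b [c [-> -> [/singleton_set/point -> /singleton_set/point -> _]]]] //|].
move=> [-> ->]; exists (fun=> a), (fun=> a); split=> //.
by split=> //; apply/singleton_set.
Qed.

End SingletonObject.

(** This recovers [g] from its action by preimages: the right-hand side is the
    fibre of [g] over [a]. *)
Lemma pullback_singleton (A B : structure) (g : {d & tup B d -> A -> Prop})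
    (a : A) (y : ttup B) :
  pullback g (obj_rel (Some (singleton_pls a))) y y <->
  exists2 b : tup B (projT1 g), y = existT _ _ b & projT2 g b a.
Proof.
(* Lifts of 1-tuples have the length 1 * d, which is d only up to a cast. *)
have E (c : tup B (1 * projT1 g)) (k : 'I_1) :
    tunflat c k = tcast (mul1n (projT1 g)) c.
  by rewrite ord1; apply/funext => j; congr c; apply: val_inj.
split=> [[x [_ [[c [-> Hc]] _ /singleton_obj_rel[Ex _]]]]|[b -> Hb]].
  rewrite {x}Ex /= in c Hc *.
  exists (tcast (mul1n (projT1 g)) c); first by rewrite ttup_cast.
  by have := Hc ord0; rewrite E.
have lift_b : glift g (existT _ _ b) (existT _ 1 (fun=> a)).
  exists (tcast (esym (mul1n (projT1 g))) b); rewrite ttup_cast; split=> // k.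
  rewrite E /= (_ : tcast _ _ = b) //.
  by apply/funext => j; congr b; apply: val_inj.
by do 2 exists (existT _ 1 (fun=> a)); split=> //; apply/singleton_obj_rel.
Qed.

(** Comparing the images of the one-point objects compares the two graphs fibre
    by fibre.  Totality of one graph gives a tuple in some fibre, whose length
    identifies the two dimensions. *)
Lemma acts_by_graph_inj (A B : structure) (g g' : {d & tup B d -> A -> Prop})
    (F : functor (PLS A) (PLS B)) :
  (forall a, exists b, projT2 g b a) ->
  acts_by g F -> acts_by g' F -> g = g'.
Proof.
move=> total_g [Hg _] [Hg' _].
have fibre a (y : ttup B) :
    (exists2 b : tup B (projT1 g), y = existT _ _ b & projT2 g b a) <->
    (exists2 b : tup B (projT1 g'), y = existT _ _ b & projT2 g' b a).
  by rewrite -!pullback_singleton -Hg -Hg'.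
case: g g' total_g fibre {Hg Hg'} => [d g] [d' g'] /= total_g fibre.
apply/graph_eq.
have [a0 _] := model_nonempty A; have [b0 gb0] := total_g a0.
have [_ /ttup_inv[e _] _] := (fibre a0 (existT _ d b0)).1 (ex_intro2 _ _ b0 erefl gb0).
exists e => b a; split=> Hb.
  have [b' Eb Hb'] := (fibre a (existT _ d b)).1 (ex_intro2 _ _ b erefl Hb).
  by rewrite -(ttup_cast e) in Eb; rewrite (ttup_inj Eb).
have [b' Eb Hb'] := (fibre a (existT _ d' (tcast e b))).2 (ex_intro2 _ _ _ erefl Hb).
by rewrite ttup_cast in Eb; rewrite (ttup_inj Eb).
Qed.

Lemma graph_total (A B : structure) (i : interpretation A B) (a : A) :
  exists b, projT2 (graph i) b a.
Proof. by have [b Ub ba] := xcoord_surj i a; exists b. Qed.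

(** Quantifying over the representatives [i] of the class spares a choice of
    one; by the next lemmas the relation is a bijection. *)
Definition corresponds (A B : structure) (f : AS_hom A B) (F : PLG_hom A B) : Prop :=
  exists2 i, interp_class i = f & acts_by (graph i) (sval F).

Section Correspondence.
Variables A B : structure.

Lemma corresponds_total (f : AS_hom A B) : exists F, corresponds f F.
Proof.
have [i <-] := interp_classP f; have [F intF iF] := interp_functor_ex i.
by exists (exist _ F intF), i.
Qed.

Lemma corresponds_surj (F : PLG_hom A B) : exists f, corresponds f F.
Proof.
have [i iF] := functor_interp_ex (svalP F).
by exists (interp_class i), i.
Qed.

Lemma corresponds_functional (f : AS_hom A B) F F' :
  corresponds f F -> corresponds f F' -> F = F'.
Proof.
move=> [i <- iF] [j /interp_class_eq/interp_eqP ji jF']; rewrite ji in jF'.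
case: F F' iF jF' => [F HF] [F' HF'] /= iF iF'.
by apply: eq_exist; apply: acts_by_inj iF iF'.
Qed.

Lemma corresponds_inj (f f' : AS_hom A B) F :
  corresponds f F -> corresponds f' F -> f = f'.
Proof.
move=> [i <- iF] [j <- jF]; apply/interp_class_eq/interp_eqP.
exact: acts_by_graph_inj (graph_total i) iF jF.
Qed.

End Correspondence.

Lemma corresponds_id (A : structure) :
  corresponds (@idc AS A) (@idc PLG A).
Proof.
by exists (interp_id A) => //; rewrite graph_interp_id; apply: acts_by_id.
Qed.

Lemma corresponds_comp (A B C : structure) (g : AS_hom B C) (f : AS_hom A B)
    (G : PLG_hom B C) (F : PLG_hom A B) :
  corresponds g G -> corresponds f F ->
  corresponds (AS_comp g f) (PLG_comp G F).
Proof.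
move=> [j <- jG] [i <- iF]; exists (interp_comp i j); first by rewrite AS_compE.
by rewrite graph_interp_comp; apply: acts_by_comp iF jG.
Qed.

Definition functor_of (A B : structure) (f : AS_hom A B) : PLG_hom A B :=
  sval (cid (corresponds_total f)).

Definition interp_of (A B : structure) (F : PLG_hom A B) : AS_hom A B :=
  sval (cid (corresponds_surj F)).

Lemma functor_ofP (A B : structure) (f : AS_hom A B) : corresponds f (functor_of f).
Proof. exact: svalP (cid (corresponds_total f)). Qed.

Lemma interp_ofP (A B : structure) (F : PLG_hom A B) : corresponds (interp_of F) F.
Proof. exact: svalP (cid (corresponds_surj F)). Qed.

Lemma functor_of1 (A : structure) : functor_of (@idc AS A) = @idc PLG A.
Proof. exact: corresponds_functional (functor_ofP _) (corresponds_id A). Qed.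

Lemma functor_ofM (A B C : structure) (g : AS_hom B C) (f : AS_hom A B) :
  functor_of (AS_comp g f) = PLG_comp (functor_of g) (functor_of f).
Proof.
apply: corresponds_functional (functor_ofP _) _.
exact: corresponds_comp (functor_ofP g) (functor_ofP f).
Qed.

Lemma interp_of1 (A : structure) : interp_of (@idc PLG A) = @idc AS A.
Proof. exact: corresponds_inj (interp_ofP _) (corresponds_id A). Qed.

Lemma interp_ofM (A B C : structure) (G : PLG_hom B C) (F : PLG_hom A B) :
  interp_of (PLG_comp G F) = AS_comp (interp_of G) (interp_of F).
Proof.
apply: corresponds_inj (interp_ofP _) _.
exact: corresponds_comp (interp_ofP G) (interp_ofP F).
Qed.

Lemma functor_ofK (A B : structure) : cancel (@functor_of A B) (@interp_of A B).
Proof. by move=> f; apply: corresponds_inj (interp_ofP _) (functor_ofP f). Qed.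

Lemma interp_ofK (A B : structure) : cancel (@interp_of A B) (@functor_of A B).
Proof. by move=> F; apply: corresponds_functional (functor_ofP _) (interp_ofP F). Qed.

Definition AS_to_PLG : functor AS PLG :=
  @Functor AS PLG id functor_of functor_of1 functor_ofM.

Definition PLG_to_AS : functor PLG AS :=
  @Functor PLG AS id interp_of interp_of1 interp_ofM.

Lemma functor_eq_id (C : category) (m : forall x y : obj C, hom x y -> hom x y)
    m1 mM :
  (forall x y (f : hom x y), m x y f = f) -> @Functor C C id m m1 mM = functor_id C.
Proof.
move=> H; have mE : m = fun _ _ => id.
  apply/functional_extensionality_dep => x; apply/functional_extensionality_dep => y.
  by apply/funext => f; apply: H.
by case: _ / (esym mE) m1 mM {H} => m1 mM; congr Functor; apply: Prop_irrelevance.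
Qed.

Theorem theorem15 : isomorphic AS PLG.
Proof.
exists AS_to_PLG, PLG_to_AS; split; apply: functor_eq_id => A B.
- exact: functor_ofK.
- exact: interp_ofK.
Qed.
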